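(* Let $\mathcal{X}\subset\mathbb{R}^d$ be compact and let $\sigma>0$. The kernel $k_{set}:\mathscr{L}^*(\mathcal{X})\times\mathscr{L}^*(\mathcal{X})\to\mathbb{R}$ defined by $$k_{set}(\gamma_1,\gamma_2)=\exp\left(-\frac{\lambda(\gamma_1\Delta\gamma_2)}{2\sigma^2}\right)$$ is characteristic; that is, the kernel mean embedding $\mathbb{P}\mapsto\mu_{k_{set}}(\mathbb{P})=\int k_{set}(\gamma,\cdot)\,d\mathbb{P}(\gamma)$, from the set of Borel probability measures on $(\mathscr{L}^*(\mathcal{X}),\delta)$ to the reproducing kernel Hilbert space of $k_{set}$, is injective.
   Context: $\lambda$ denotes Lebesgue measure on $\mathcal{X}$ and $\mathscr{L}(\mathcal{X})$ the collection of all Lebesgue-measurable subsets of $\mathcal{X}$. For $\gamma_1,\gamma_2\in\mathscr{L}(\mathcal{X})$, $\gamma_1\Delta\gamma_2=(\gamma_1\cup\gamma_2)\setminus(\gamma_1\cap\gamma_2)$ and $\delta(\gamma_1,\gamma_2)=\lambda(\gamma_1\Delta\gamma_2)$, which is a pseudo-metric. $\mathscr{L}^*(\mathcal{X})$ is the quotient of $\mathscr{L}(\mathcal{X})$ by the equivalence relation $\delta(\gamma_1,\gamma_2)=0$; $\delta$ induces a metric on it, and $\mathscr{L}^*(\mathcal{X})$ is equipped with the Borel $\sigma$-algebra of this metric. A kernel is a symmetric function $k:\mathcal{Z}\times\mathcal{Z}\to\mathbb{R}$ that is positive definite in the sense that $\sum_{i,j=1}^n\alpha_i\alpha_jk(z_i,z_j)\ge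 0$ for all $n\geq 1$, $\alpha_i\in\mathbb{R}$, $z_i\in\mathcal{Z}$. The function $k_{set}$ is a bounded measurable kernel, so its mean embedding is well defined. *)

(* Defs.v *)
From HB Require Import structures.
From mathcomp Require Import all_boot all_order all_algebra.
From mathcomp Require Import all_classical all_reals all_analysis.
Set Implicit Arguments.
Unset Strict Implicit.
Unset Printing Implicit Defensive.
Import Order.TTheory GRing.Theory Num.Theory.
Import numFieldNormedType.Exports.
Local Open Scope classical_set_scope.
Local Open Scope ring_scope.

Section lebesgue_outer_measure.
Context {R : realType} (d : nat).
Local Notation Rd := 'rV[R]_d.

Definition box (ab : Rd * Rd) : set Rd :=
  [set x | forall i, ab.1 ord0 i <= x ord0 i <= ab.2 ord0 i].

(* The truncation gives volume 0 to boxes with a reversed side. *)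
Definition box_volume (ab : Rd * Rd) : R :=
  \prod_(i < d) Num.max 0 (ab.2 ord0 i - ab.1 ord0 i).

(* A finite or countable cover: [c.1] is the set of indices in use.  Allowing
   the empty cover makes the definition correct for [d = 0] too. *)
Definition box_cover (A : set Rd) : set (set nat * (nat -> Rd * Rd)) :=
  [set c | A `<=` \bigcup_(k in c.1) box (c.2 k)].

Definition lebesgue_outer (A : set Rd) : \bar R :=
  ereal_inf [set \esum_(k in c.1) (box_volume (c.2 k))%:E | c in box_cover A].

Lemma box_volume_ge0 ab : 0 <= box_volume ab.
Proof. by apply: prodr_ge0 => i _; rewrite le_max lexx. Qed.

Lemma lebesgue_outer_ge0 A : (0 <= lebesgue_outer A)%E.
Proof.
apply: le_ereal_inf_tmp => _ [c _ <-]; apply: esum_ge0 => k _.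
by rewrite lee_fin box_volume_ge0.
Qed.

Lemma lebesgue_outer0 : lebesgue_outer set0 = 0%E.
Proof.
apply/eqP; rewrite eq_le lebesgue_outer_ge0 andbT.
apply: ereal_inf_lbound; exists (set0, fun=> (0, 0)); first exact: sub0set.
by rewrite esum_set0.
Qed.

Lemma le_lebesgue_outer :
  {homo lebesgue_outer : A B / A `<=` B >-> (A <= B)%E}.
Proof.
move=> A B AB; apply: ereal_inf_le_tmp => _ [c Bc <-].
by exists c => //; exact: subset_trans Bc.
Qed.

Lemma lebesgue_outer_sigma_subadditive : sigma_subadditive lebesgue_outer.
Proof.
move=> A; have [[i ioo]|] := pselect (exists i, lebesgue_outer (A i) = +oo%E).
  rewrite (eseries_pinfty _ _ ioo) ?leey// => n _.
  by rewrite -ltNye (lt_le_trans _ (lebesgue_outer_ge0 _)).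
rewrite -forallNE => Aoo; apply/lee_addgt0Pr => _/posnumP[e].
rewrite (le_trans _ (epsilon_trick xpredT _ _))//; last first.
  by move=> n; exact: lebesgue_outer_ge0.
pose P n (c : set nat * (nat -> Rd * Rd)) := box_cover (A n) c /\
  (\esum_(k in c.1) (box_volume (c.2 k))%:E
     <= lebesgue_outer (A n) + (e%:num / (2 ^ n.+1)%:R)%:E)%E.
have [G PG] : {G : nat -> _ & forall n, P n (G n)}.
  apply: (@choice _ _ P) => n.
  have Afin : lebesgue_outer (A n) \is a fin_num.
    by rewrite ge0_fin_numE ?lebesgue_outer_ge0// ltey; exact/eqP/Aoo.
  have en1 : 0 < e%:num / (2 ^ n.+1)%:R :> R by [].
  have [_ [c cA <-] cle] := lb_ereal_inf_adherent en1 Afin.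
  by exists c; split => //; exact: ltW.
have /card_esym/ppcard_eqP[f] := card_nat2.
pose D : set nat := [set m | (G (f m).1).1 (f m).2].
pose C m := (G (f m).1).2 (f m).2.
have vol_ge0 ab : (0 <= (box_volume ab)%:E)%E by rewrite lee_fin box_volume_ge0.
apply: (@le_trans _ _ (\esum_(m in D) (box_volume (C m))%:E)%E).
  apply: ereal_inf_lbound; exists (D, C) => //= x [n _ Anx].
  have [k Gk xk] := (PG n).1 _ Anx.
  by exists (f^-1%FUN (n, k)); rewrite /D /C/= invK ?inE.
pose K := [set: nat] `*`` (fun n => (G n).1).
have bijf : set_bij D K f.
  split; first by move=> m Dm; split.
    by move=> x y _ _; exact: injT.
  by move=> [n k] [_ /= Gk]; exists (f^-1%FUN (n, k)); rewrite /D/= invK ?inE.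
rewrite -(reindex_esum _ _ _
  (fun nk : nat * nat => (box_volume ((G nk.1).2 nk.2))%:E) bijf).
rewrite -(@esum_esum _ _ _ setT (fun n => (G n).1)
  (fun n k => (box_volume ((G n).2 k))%:E))//.
rewrite -nneseries_esumT; last by move=> n; exact: esum_ge0.
by apply: lee_nneseries => n *; [exact: esum_ge0 | exact: (PG n).2].
Qed.

HB.instance Definition _ := isOuterMeasure.Build R Rd lebesgue_outer
  lebesgue_outer0 lebesgue_outer_ge0 le_lebesgue_outer
  lebesgue_outer_sigma_subadditive.

(* Carathéodory's definition; the sigma-algebra is Lebesgue-complete. *)
Definition lebesgue_measurable : set (set Rd) :=
  lebesgue_outer.-cara.-measurable.

Lemma lebesgue_outer_compact (X : set Rd) :
  compact X -> (lebesgue_outer X < +oo)%E.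
Proof.
move=> cX.
have bnd i : exists M : R, forall x, X x -> `|x ord0 i| <= M.
  have /compact_bounded[M [_ XM]] :
      compact ((fun x : Rd => x ord0 i : R^o) @` X).
    apply: continuous_compact => //; apply: continuous_subspaceT => x.
    exact: coord_continuous.
  exists (M + 1) => x Xx; apply: (XM (M + 1)); first by rewrite ltrDl.
  by exists x.
have [M XM] := choice bnd.
pose ab : Rd * Rd := (\row_i - M i, \row_i M i).
apply: (@le_lt_trans _ _ (\esum_(k in [set 0%N]) (box_volume ab)%:E)%E).
  apply: ereal_inf_lbound; exists ([set 0%N], fun=> ab) => //= x Xx.
  by exists 0%N => // i; rewrite !mxE -ler_norml XM.
by rewrite esum_set1 ?ltry// lee_fin box_volume_ge0.
Qed.

End lebesgue_outer_measure.

Section set_space.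
Context {R : realType} {d : nat} {X : set 'rV[R]_d}.
Local Notation lambda := (@lebesgue_outer R d).

Definition Lset : Type :=
  [set A : set 'rV[R]_d | lebesgue_measurable A /\ A `<=` X].
HB.instance Definition _ := Choice.on Lset.

Definition delta (A B : Lset) : \bar R := lambda (val A `+` val B).

Definition delta_eq (A B : Lset) : bool := `[< delta A B = 0%E >].

Lemma delta_ge0 A B : (0 <= delta A B)%E.
Proof. exact: outer_measure_ge0. Qed.

Lemma deltaxx A : delta A A = 0%E.
Proof. by rewrite /delta setYK outer_measure0. Qed.

Lemma delta_sym A B : delta A B = delta B A.
Proof. by rewrite /delta setYC. Qed.

Lemma delta_triangle B A C : (delta A C <= delta A B + delta B C)%E.
Proof.
apply: (@le_trans _ _ (lambda ((val A `+` val B) `|` (val B `+` val C)))).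
  apply: le_outer_measure => x /= [[Ax Cx]|[Cx Ax]].
    by have [Bx|Bx] := pselect (val B x); [right; left|left; left].
  by have [Bx|Bx] := pselect (val B x); [left; right|right; right].
exact: outer_measureU2.
Qed.

Lemma delta_eq_refl : reflexive delta_eq.
Proof. by move=> A; apply/asboolP; exact: deltaxx. Qed.

Lemma delta_eq_sym : symmetric delta_eq.
Proof. by move=> A B; rewrite /delta_eq delta_sym. Qed.

Lemma delta_eq_trans : transitive delta_eq.
Proof.
move=> B A C /asboolP AB /asboolP BC; apply/asboolP/eqP.
by rewrite eq_le delta_ge0 andbT (le_trans (delta_triangle B A C))// AB BC adde0.
Qed.

Canonical delta_eq_equiv :=
  EquivRel delta_eq delta_eq_refl delta_eq_sym delta_eq_trans.

End set_space.
Arguments Lset {R d} X.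

Section Lstar.
Local Open Scope quotient_scope.
Context {R : realType} {d : nat} {X : set 'rV[R]_d}.

(* The compactness proof is a parameter of the type because it makes [delta]
   finite, so that the quotient is a genuine metric space. *)
Definition Lstar (cX : compact X) : Type :=
  {eq_quot (@delta_eq R d X)}.

Variable cX : compact X.
HB.instance Definition _ := Choice.on (Lstar cX).
HB.instance Definition _ := EqQuotient.on (Lstar cX).

Definition Lstar_dist (a b : Lstar cX) : R := fine (delta (repr a) (repr b)).

Lemma delta_fin (A B : Lset X) : delta A B \is a fin_num.
Proof.
rewrite ge0_fin_numE ?delta_ge0//; apply: le_lt_trans (lebesgue_outer_compact cX).
have [_ AX] := set_mem (valP A); have [_ BX] := set_mem (valP B).
by apply: le_outer_measure => x /= [[/AX]|[/BX]].
Qed.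

Lemma Lstar_distxx a : Lstar_dist a a = 0.
Proof. by rewrite /Lstar_dist deltaxx. Qed.

Lemma Lstar_dist_positivity a b : Lstar_dist a b = 0 -> a = b.
Proof.
move=> /(congr1 (@EFin R)); rewrite fineK ?delta_fin// => ab0.
rewrite -(reprK a) -(reprK b); apply/eqP; rewrite eqmodE.
exact/asboolP.
Qed.

Lemma Lstar_dist_sym a b : Lstar_dist a b = Lstar_dist b a.
Proof. by rewrite /Lstar_dist delta_sym. Qed.

Lemma Lstar_dist_triangle b a c :
  Lstar_dist a c <= Lstar_dist a b + Lstar_dist b c.
Proof.
by rewrite -lee_fin EFinD !fineK ?delta_fin//; exact: delta_triangle.
Qed.

Lemma Lstar_dist_pi (A B : Lset X) :
  Lstar_dist (\pi_(Lstar cX) A) (\pi_(Lstar cX) B) = fine (delta A B).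
Proof.
have repr0 C : delta (repr (\pi_(Lstar cX) C)) C = 0%E.
  by apply/asboolP; rewrite -/(delta_eq _ _) -eqmodE reprK.
have le A1 A2 B1 B2 : delta A1 A2 = 0%E -> delta B1 B2 = 0%E ->
    (delta A1 B1 <= delta A2 B2)%E.
  move=> A12 B12; rewrite (le_trans (delta_triangle A2 _ _))// A12 add0e.
  by rewrite (le_trans (delta_triangle B2 _ _))// (delta_sym B2) B12 adde0.
by congr fine; apply/eqP; rewrite eq_le !le// delta_sym.
Qed.

HB.instance Definition _ := @isMetric.Build R (Lstar cX) Lstar_dist
  Lstar_distxx Lstar_dist_positivity Lstar_dist_sym Lstar_dist_triangle.

Lemma Lset0_subproof :
  set0 \in [set A : set 'rV[R]_d | lebesgue_measurable A /\ A `<=` X].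
Proof. by apply/mem_set; split; [exact: measurable0|exact: sub0set]. Qed.

HB.instance Definition _ := isPointed.Build (Lstar cX)
  (\pi_(Lstar cX) (exist _ set0 Lset0_subproof : Lset X)).

(* The same carrier, equipped with the Borel sigma-algebra of the metric. *)
Definition LstarB : Type := g_sigma_algebraType (@open (Lstar cX)).
HB.instance Definition _ := Measurable.on LstarB.

Definition k_set (sigma : R) (a b : LstarB) : R :=
  expR (- fine (lebesgue_outer (val (repr (a : Lstar cX)) `+`
                                val (repr (b : Lstar cX))))
        / (2 * sigma ^+ 2)).

End Lstar.
Arguments k_set {R d X} cX sigma a b.

(* A reproducing kernel Hilbert space of [k], unique up to isometry.
   Completeness comes from [completeNormedModType]; [rkhs_fun] identifies an
   element with the function on [T] that it is. *)
Record rkhs (R : realType) (T : Type) (k : T -> T -> R) := Rkhs {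
  rkhs_space :> completeNormedModType R;
  rkhs_dot : rkhs_space -> rkhs_space -> R;
  rkhs_dotC : forall f g, rkhs_dot f g = rkhs_dot g f;
  rkhs_dot_linear : forall c f g h,
    rkhs_dot (c *: f + g) h = c * rkhs_dot f h + rkhs_dot g h;
  rkhs_dot_norm : forall f, rkhs_dot f f = `|f| ^+ 2;
  rkhs_fun : rkhs_space -> T -> R;
  rkhs_fun_linear : forall c f g x,
    rkhs_fun (c *: f + g) x = c * rkhs_fun f x + rkhs_fun g x;
  rkhs_fun_inj : injective rkhs_fun;
  rkhs_section : T -> rkhs_space;
  rkhs_sectionE : forall x y, rkhs_fun (rkhs_section x) y = k x y;
  rkhs_reproducing : forall f x, rkhs_fun f x = rkhs_dot f (rkhs_section x)
}.

Section bochner.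
Context {R : realType} {disp : measure_display} {T : measurableType disp}.
Context {V : completeNormedModType R}.
Variable P : probability T R.

Definition simple_integral (s : {fimfun T >-> V}) : V :=
  \sum_(v \in range s) fine (P (s @^-1` [set v])) *: v.

Definition is_bochner_integral (F : T -> V) (m : V) : Prop :=
  exists s : nat -> {fimfun T >-> V},
    [/\ forall n v, measurable (s n @^-1` [set v]),
        {ae P, forall x, s n x @[n --> \oo] --> F x},
        (\int[P]_x (`|F x - s n x|)%:E)%E @[n --> \oo] --> 0%E &
        simple_integral (s n) @[n --> \oo] --> m].

(* Defaults to 0 when [F] is not Bochner integrable. *)
Definition bochner_integral (F : T -> V) : V :=
  xget 0 [set m | is_bochner_integral F m].

End bochner.

Section characteristic.
Context {R : realType} {disp : measure_display} {T : measurableType disp}.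

Definition mean_embedding (k : T -> T -> R) (H : rkhs k)
  (P : probability T R) : H := bochner_integral P (@rkhs_section R T k H).

(* Library measures are functions on all sets, with unconstrained values outside
   the sigma-algebra, so two of them are the same measure when they agree on
   measurable sets. *)
Definition characteristic (k : T -> T -> R) : Prop :=
  forall (H : rkhs k) (P Q : probability T R),
    mean_embedding H P = mean_embedding H Q ->
    forall A : set T, measurable A -> P A = Q A.

End characteristic.

(* Main.v *)
From HB Require Import structures.
Require Import Defs.
From mathcomp Require Import all_boot all_order all_algebra.
From mathcomp Require Import all_classical all_reals all_analysis.
From mathcomp Require Import finmap measurable_realfun ring lra.
Set Implicit Arguments.
Unset Strict Implicit.
Unset Printing Implicit Defensive.
Import Order.TTheory GRing.Theory Num.Theory.
Import numFieldNormedType.Exports.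
Local Open Scope classical_set_scope.
Local Open Scope ring_scope.

(* Equal mean embeddings mean that [P] and [Q] give the same integral to every
   function [x |-> exp (- c d(x, a))], [c = 1 / (2 sigma^2)].  Cut [X] into small
   cells [C_p].  The distance from [x] to a union of cells is affine in the
   numbers [x_p = lambda (x `&` C_p)], and expanding a product
   [\prod_p (u_p exp (- c x_p) + v_p exp (c x_p))] gives a linear combination of
   kernel functions, one for each union of cells.  With [u_p + v_p = 1] and
   [c (v_p - u_p) = b_p] the factor is [exp (b_p x_p)] up to [O(x_p^2)], so, since
   Lebesgue measure has no atoms, [exp (\sum_p b_p x_p)] is a uniform limit of such
   combinations when the cells shrink.  Hence [P] and [Q] agree on
   [exp (a \sum_i d(x, g_i))] for all real [a] and all [g_i].  Sums of these form
   an algebra; [exp (- \sum_i n exp (n (d(x, g_i) - r_i)))] is a power series in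
   one of them and tends to the indicator of a finite intersection of balls.
   These intersections generate the Borel sets because the space is separable.
   In dimension 0, where the measure has an atom, the space has at most two
   points. *)

(** * Functions with the same integral under two probabilities *)

Lemma norm_cvg_le {R : realType} (u : R^nat) (l M : R) :
  (forall n, `|u n| <= M) -> u @ \oo --> l -> `|l| <= M.
Proof.
move=> uM ul; have nul : `|u n| @[n --> \oo] --> `|l| by exact: cvg_norm.
rewrite -(cvg_lim _ nul)//; apply: limr_le; first by apply/cvg_ex; exists `|l|.
exact: nearW.
Qed.

Section bounded_functions.
Context {d : measure_display} {T : measurableType d} {R : realType}.
Implicit Types (P Q : probability T R) (f g : T -> R).

Lemma integrable_bounded P f (M : R) : measurable_fun setT f ->
  (forall x, `|f x| <= M) -> P.-integrable setT (EFin \o f).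
Proof.
move=> mf fM; apply: measurable_bounded_integrable => //.
  by rewrite ltey_eq fin_num_measure.
exists M; split; first exact: num_real.
by move=> y My x _ /=; rewrite (le_trans (fM x))// ltW.
Qed.

Lemma cvg_Rintegral_bounded P (h : (T -> R)^nat) f (M : R) :
  (forall n, measurable_fun setT (h n)) -> (forall n x, `|h n x| <= M) ->
  (forall x, h ^~ x @ \oo --> f x) ->
  (\int[P]_x h n x)%R @[n --> \oo] --> (\int[P]_x f x)%R.
Proof.
move=> mh hM hf.
have mf : measurable_fun setT f by apply: (measurable_fun_cvg mh) => x _; exact: hf.
have fM x : `|f x| <= M by exact: norm_cvg_le (hf x).
apply: fine_cvg; rewrite fineK; last first.
  exact/integrable_fin_num/(integrable_bounded _ mf fM).
apply: (@dominated_cvg _ _ _ P setT measurableT (fun n x => (h n x)%:E)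
   (fun x => (f x)%:E) (cst M%:E)) => //.
- by move=> n; apply/measurable_EFinP.
- by move=> x _; apply: cvg_EFin; [exact: nearW | exact: hf].
- by apply: finite_measure_integrable_cst.
- by move=> n x _; rewrite lee_fin.
Qed.

(** Bundling measurability and boundedness with equality of the integrals makes the class stable
    under linear combinations and bounded pointwise limits. *)
Definition agree P Q f :=
  [/\ measurable_fun setT f, exists M : R, forall x, `|f x| <= M &
      (\int[P]_x f x)%R = (\int[Q]_x f x)%R].

Variables P Q : probability T R.
Local Notation agr := (agree P Q).

Lemma agree_lim (h : (T -> R)^nat) f (M : R) : (forall n, agr (h n)) ->
  (forall n x, `|h n x| <= M) -> (forall x, h ^~ x @ \oo --> f x) -> agr f.
Proof.
move=> ah hM hf.
have mh n : measurable_fun setT (h n) by case: (ah n).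
split.
- by apply: (measurable_fun_cvg mh) => x _; exact: hf.
- by exists M => x; exact: norm_cvg_le (hf x).
- have hP := cvg_Rintegral_bounded (P := P) mh hM hf.
  have hQ := cvg_Rintegral_bounded (P := Q) mh hM hf.
  apply: (cvg_unique _ hP) => //; rewrite (_ : (fun n => _) = (fun n => \int[Q]_x h n x))//.
  by apply/funext => n; case: (ah n).
Qed.

Lemma agree_cst (c : R) : agr (fun=> c).
Proof.
split; [exact: measurable_cst | by exists `|c| |].
rewrite !Rintegral_cst//; congr (_ * fine _).
exact: etrans (probability_setT P) (esym (probability_setT Q)).
Qed.

Lemma agreeZ (c : R) f : agr f -> agr (fun x => c * f x).
Proof.
move=> [mf [M fM] PQf]; split.
- exact: measurable_funM.
- by exists (`|c| * M) => x; rewrite normrM ler_wpM2l.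
- by rewrite !RintegralZl// ?PQf//; exact: (integrable_bounded _ mf fM).
Qed.

Lemma agreeD f g : agr f -> agr g -> agr (fun x => f x + g x).
Proof.
move=> [mf [M fM] PQf] [mg [N gN] PQg]; split.
- exact: measurable_funD.
- by exists (M + N) => x; rewrite (le_trans (ler_normD _ _))// lerD.
- by rewrite !RintegralD// ?PQf ?PQg//;
    solve [exact: (integrable_bounded _ mf fM)|exact: (integrable_bounded _ mg gN)].
Qed.

Lemma agree_sum (I : Type) (s : seq I) (p : pred I) (h : I -> T -> R) :
  (forall i, p i -> agr (h i)) -> agr (fun x => \sum_(i <- s | p i) h i x).
Proof.
move=> ah; elim: s => [|i s ih].
  by under eq_fun do rewrite big_nil; exact: agree_cst.
under eq_fun do rewrite big_cons.
by case: (boolP (p i)) => [pr_i|//]; apply: agreeD => //; exact: ah.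
Qed.

Lemma agree_approx f :
  (forall e, 0 < e -> exists2 g, agr g & forall x, `|f x - g x| <= e) ->
  agr f.
Proof.
move=> fg.
have /choice[g /all_and2[ag gf]] (n : nat) :
    exists g, agr g /\ forall x, `|f x - g x| <= n.+1%:R^-1.
  by have [|g ag gf] := fg n.+1%:R^-1; [rewrite invr_gt0|exists g].
have [_ [M gM] _] := ag 0%N.
(* [M] bounds [g 0], and both [f - g 0] and [f - g n] are bounded by 1. *)
apply: (@agree_lim g f (M + 2)) => //.
- move=> n x; have le1 m : m.+1%:R^-1 <= 1 :> R by rewrite invf_le1// ler1n.
  have := ler_normB (g 0%N x + (f x - g 0%N x)) (f x - g n x).
  have := ler_normD (g 0%N x) (f x - g 0%N x).
  rewrite (_ : _ + _ - _ = g n x); last lra.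
  have := gM x; have := le_trans (gf 0%N x) (le1 0%N).
  by have := le_trans (gf n x) (le1 n); lra.
- move=> x; apply/cvgrPdist_le => e e0; near=> n.
  rewrite (le_trans (gf n x))// ltW//; near: n.
  exact: near_infty_natSinv_lt (PosNum e0).
Unshelve. all: by end_near.
Qed.

(** The partial sums of the exponential series are dominated by [expR M] for a bound [M] of [|u|],
    so dominated convergence applies. *)
Lemma agree_expRN u : (forall k, agr (fun x => u x ^+ k)) ->
  agr (fun x => expR (- u x)).
Proof.
move=> au; have [_ [M uM] _] := au 1%N.
have M0 : 0 <= M.
  by have := le_trans (normr_ge0 _) (uM point).
apply: (@agree_lim (fun n x => series (exp_coeff (- u x)) n) _ (expR M)).
- move=> n; apply: agree_sum => k _.
  rewrite (_ : (fun x => _) = (fun x => ((-1) ^+ k / k`!%:R) * u x ^+ k)); last first.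
    by apply/funext => x; rewrite /exp_coeff/= (exprNn (u x)) mulrAC.
  exact: (agreeZ _ (au k)).
- move=> n x; rewrite (le_trans (ler_norm_sum _ _ _))//.
  apply: (@le_trans _ _ (series (exp_coeff M) n)).
    apply: ler_sum => k _; rewrite /exp_coeff/= normrM normrX normrN.
    rewrite ger0_norm ?invr_ge0// ler_wpM2r ?invr_ge0// lerXn2r ?nnegrE//.
    by have := uM x; rewrite expr1.
  apply: nondecreasing_cvgn_le; last exact: is_cvg_series_exp_coeff.
  apply/nondecreasing_seqP => k; rewrite /series/= big_nat_recr//= lerDl.
  exact: exp_coeff_ge0.
- by move=> x; exact: is_cvg_series_exp_coeff.
Qed.

End bounded_functions.

(** For [w < 0] the quadratic lower bound of [expR] beats the factor [n]; for [w >= 0] the term is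
    at most [expR (- n)]. The case [w = 0] falls on the zero side, hence the strict inequality in
    [ball_cap]. *)
Lemma cvg_double_expR {R : realType} (w : R) :
  expR (- (n%:R * expR (n%:R * w))) @[n --> \oo] --> ((w < 0)%R%:R : R).
Proof.
case: ltP => w0 /=.
- suff : expR (- (n%:R * expR (n%:R * w))) @[n --> \oo] --> expR (- 0).
    by rewrite oppr0 expR0.
  apply: (@continuous_cvg _ _ _ _ _ _ (fun x => expR (- x)) 0).
    by apply: continuous_comp; [exact: continuousN|exact: continuous_expR].
  apply/cvgrPdist_le => e e0; near=> n.
  rewrite sub0r normrN ger0_norm ?mulr_ge0 ?expR_ge0//.
  have n0 : 0 < n%:R :> R by rewrite ltr0n; near: n; exists 1%N.
  have nw : 0 <= n%:R * - w by rewrite mulr_ge0// oppr_ge0 ltW.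
  have := expR_ge1Dxn 1 nw; rewrite mulrN expRN => h.
  have {}h : (n%:R * w) ^+ 2 / 2 <= (expR (n%:R * w))^-1.
    by apply: le_trans h; rewrite sqrrN lerDr.
  (* The bound obtained for [n * expR (n * w)] is [2 / (w ^ 2 * n)], which is then at most [e]. *)
  have nE : 2 / (w ^+ 2 * e) <= n%:R by near: n; exact: nbhs_infty_ger.
  have w2 : 0 < w ^+ 2 by rewrite exprn_even_gt0//= lt_eqF.
  have {}h : expR (n%:R * w) <= ((n%:R * w) ^+ 2 / 2)^-1.
    rewrite -[leLHS]invrK lef_pV2 ?posrE ?invr_gt0 ?expR_gt0//.
    by rewrite divr_gt0// exprMn mulr_gt0// exprn_gt0.
  apply: (le_trans (ler_wpM2l (ltW n0) h)).
  rewrite (_ : _ * _ = 2 / (w ^+ 2 * e) / n%:R * e); last first.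
    by field; rewrite (gt_eqF n0) (gt_eqF e0) lt_eqF.
  by rewrite ler_piMl ?(ltW e0)// ler_pdivrMr// mul1r.
- apply: (@squeeze_cvgr _ _ _ _ (cst 0) (fun n => expR (- n%:R))).
  + near=> n; rewrite expR_ge0/= ler_expR lerN2 ler_peMr//.
    by rewrite -expR0 ler_expR mulr_ge0.
  + exact: cvg_cst.
  + exact: cvgn_expR.
Unshelve. all: by end_near.
Qed.

(** * From exponentials of distances to finite intersections of balls *)

Section determination.
Context {d : measure_display} {T : measurableType d} {R : realType}.
Context {G : Type}.
Variables (P Q : probability T R) (D : T -> G -> R).

(** With lists of centres and radii, concatenation is intersection and the empty list is the whole
    space, so these sets form a pi-system. *)
Definition ball_cap (L : seq (G * R)) : set T :=
  [set x | all (fun p => D x p.1 < p.2) L].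

Hypothesis agree_exp : forall (a : R) (s : seq G),
  agree P Q (fun x => expR (a * \sum_(g <- s) D x g)).

(** Expanding one factor of the power moves a centre of [L] into [s]; the induction therefore needs
    the extra exponential with [s] arbitrary. *)
Lemma agree_exp_pow (L : seq (G * R)) (c : G * R -> R) (a : R) k (s : seq G) :
  agree P Q (fun x => (\sum_(p <- L) c p * expR (a * D x p.1)) ^+ k
                      * expR (a * \sum_(g <- s) D x g)).
Proof.
elim: k s => [|k ih] s.
  by under eq_fun do rewrite expr0 mul1r; exact: agree_exp.
under eq_fun do rewrite exprS -mulrA mulr_suml.
apply: agree_sum => p _.
rewrite (_ : (fun x => _) = (fun x => c p *
  ((\sum_(p <- L) c p * expR (a * D x p.1)) ^+ k *
   expR (a * \sum_(g <- p.1 :: s) D x g)))); last first.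
  by apply/funext => x; rewrite big_cons mulrDr expRD; ring.
by apply: agreeZ; exact: ih.
Qed.

Lemma agree_ball_cap L : agree P Q \1_(ball_cap L).
Proof.
apply: (@agree_lim _ _ _ _ _ (fun n x => expR (- \sum_(p <- L)
  (n%:R * expR (n%:R * (D x p.1 - p.2))))) _ 1).
- move=> n; apply: agree_expRN => k.
  (* The radii go into the coefficients: [n expR (n (D - r))] is [n expR (- n r)] times
     [expR (n D)]. *)
  have := agree_exp_pow L (fun p => n%:R * expR (- (n%:R * p.2))) n%:R k [::].
  congr agree; apply/funext => x; rewrite big_nil mulr0 expR0 mulr1; congr (_ ^+ _).
  by apply: eq_bigr => p _; rewrite mulrBr expRD; ring.
- move=> n x; rewrite ger0_norm ?expR_ge0// expR_le1 oppr_le0.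
  by apply: sumr_ge0 => p _; rewrite mulr_ge0// expR_ge0.
- move=> x; rewrite indicE (_ : (x \in ball_cap L) = all (fun p => D x p.1 < p.2) L); last first.
    by apply/idP/idP => [/set_mem//|h]; exact: mem_set.
  elim: L => [|p L ih] /=.
    by under eq_fun do rewrite big_nil oppr0 expR0; exact: cvg_cst.
  under eq_fun do rewrite big_cons opprD expRD.
  by rewrite -mulnb natrM; apply: cvgM => //; rewrite -subr_lt0; exact: cvg_double_expR.
Qed.

(** Read off from the indicator, which is measurable as a pointwise limit of measurable
    functions. *)
Lemma ball_cap_measurable L : measurable (ball_cap L).
Proof. by apply/(measurable_indicP R); case: (agree_ball_cap L). Qed.

Lemma probability_eq_ball_cap L : P (ball_cap L) = Q (ball_cap L).
Proof.
have mL := ball_cap_measurable L; have [_ _] := agree_ball_cap L.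
rewrite /Rintegral !integral_indic// !setIT => PQ; move: (congr1 EFin PQ).
by rewrite !fineK// fin_num_measure.
Qed.

(** Two finite measures that agree on a pi-system containing the whole space agree on the
    sigma-algebra it generates. *)
Lemma probability_eq_g_sigma_ball_cap (A : set T) :
  <<s range ball_cap >> A -> P A = Q A.
Proof.
apply: (g_sigma_algebra_measure_unique (range ball_cap) _ (fun=> setT)) => //.
- by move=> _ [L _ <-]; exact: ball_cap_measurable.
- by move=> _; exists [::] => //; apply/seteqP; split.
- by rewrite bigcup_const//; exists 0%N.
- move=> _ _ [L _ <-] [L' _ <-]; exists (L ++ L') => //; apply/seteqP.
  by split=> x; rewrite /ball_cap/= all_cat => /andP.
- by move=> _ [L _ <-]; exact: probability_eq_ball_cap.
- by move=> _; rewrite ltey_eq fin_num_measure.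
Qed.

End determination.
(** * Bochner integrals in a reproducing kernel Hilbert space *)

Section nearest_index.
Context {d : measure_display} {T : measurableType d} {R : realType}.
Variable a : nat -> T -> R.
Hypothesis ma : forall i, measurable_fun setT (a i).

(** A minimiser of [a i x] over [i <= n], ties going to the smallest index. Applied to distances to
    a dense sequence, it selects the values of the approximating simple functions. *)
Fixpoint nearest (n : nat) (x : T) : nat :=
  if n is m.+1 then if a m.+1 x < a (nearest m x) x then m.+1 else nearest m x
  else 0%N.

Lemma nearest_le n x : (nearest n x <= n)%N.
Proof. by elim: n => //= n ih; case: ifP => // _; exact: leqW. Qed.

Lemma nearest_min n x i : (i <= n)%N -> a (nearest n x) x <= a i x.
Proof.
elim: n => [|n ih] /=; first by rewrite leqn0 => /eqP ->.
rewrite leq_eqVlt ltnS => /predU1P[->|/ih h]; case: ltP => //.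
by move=> /ltW /le_trans; apply.
Qed.

Lemma measurable_nearest n i : measurable [set x | nearest n x = i].
Proof.
elim: n i => [|n ih] i /=.
  have [->|i0] := eqVneq i 0%N.
    by rewrite (_ : [set _ | _] = setT)//; apply/seteqP; split.
  rewrite (_ : [set _ | _] = set0)//; apply/seteqP; split => // x /= /esym/eqP.
  by rewrite (negbTE i0).
pose A := [set x | a n.+1 x < a (nearest n x) x].
have mA : measurable A.
  (* Splitting by the previous index replaces an index depending on [x] by a fixed one. *)
  rewrite (_ : A = \bigcup_j ([set x | nearest n x = j] `&` [set x | a n.+1 x < a j x])).
    apply: bigcupT_measurable => j; apply: measurableI => //.
    rewrite -[X in measurable X]setTI.
    exact: (measurable_fun_ltr (ma n.+1) (ma j) measurableT (Y := [set true])).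
  apply/seteqP; split => x /=; first by exists (nearest n x).
  by move=> [j _ [/= <-]].
rewrite (_ : [set _ | _] = (A `&` [set x | n.+1 = i]) `|`
                           (~` A `&` [set x | nearest n x = i])).
  apply: measurableU; apply: measurableI => //; last exact: measurableC.
  have [->|ni] := eqVneq n.+1 i.
    by rewrite (_ : [set _ | _] = setT)//; apply/seteqP; split.
  rewrite (_ : [set _ | _] = set0)//; apply/seteqP; split => // x /= /eqP.
  by rewrite (negbTE ni).
apply/seteqP; split => x /=; rewrite /A /=.
  by case: ifPn => h e; [left|right; split => //; exact/negP].
by move=> [[->]|[/negP/negbTE ->]].
Qed.

End nearest_index.

(** * Simple functions with values in a normed space *)

Section simple_functions.
Context {d : measure_display} {T : measurableType d} {R : realType}.
Context {V : completeNormedModType R}.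
Variable s : {fimfun T >-> V}.
Hypothesis ms : forall v, measurable (s @^-1` [set v]).

(** Only the term [v = s x] survives. The dependence of [psi] on [x] covers functions such as
    [|F x - s x|]. *)
Lemma fimfun_comp_sumE (psi : T -> V -> R) x :
  psi x (s x) = \sum_(v <- fset_set (range s)) psi x v * \1_(s @^-1` [set v]) x.
Proof.
rewrite (bigD1_seq (s x))/=.
- rewrite indicE mem_set// mulr1 big1 ?addr0// => v vx.
  rewrite indicE memNset ?mulr0//= => sxv; by rewrite sxv eqxx in vx.
- by rewrite in_fset_set; [apply/mem_set; exists x|exact: fimfunP].
- exact: fset_uniq.
Qed.

Lemma measurable_fimfun_comp (psi : T -> V -> R) :
  (forall v, measurable_fun setT (psi ^~ v)) ->
  measurable_fun setT (fun x => psi x (s x)).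
Proof.
move=> mpsi; under eq_fun do rewrite fimfun_comp_sumE.
apply: measurable_sum => v; exact: measurable_funM.
Qed.

Lemma fimfun_bounded (phi : V -> R) : exists M : R, forall x, `|phi (s x)| <= M.
Proof.
exists (\sum_(v <- fset_set (range s)) `|phi v|) => x.
rewrite (fimfun_comp_sumE (fun=> phi)) (le_trans (ler_norm_sum _ _ _))//.
apply: ler_sum => v _; rewrite normrM ler_piMr// indicE ger0_norm//.
by case: (_ \in _).
Qed.

(** Both sides equal the sum of [P (s = v) * phi v] over the finite range of [s]; the induction runs
    along the list of these values. *)
Lemma simple_integral_linear (P : probability T R) (phi : V -> R) :
  (forall c u v, phi (c *: u + v) = c * phi u + phi v) ->
  phi (simple_integral P s) = (\int[P]_x phi (s x))%R.
Proof.
move=> phiL.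
have phi0 : phi 0 = 0 by have := phiL 1 0 0; rewrite scaler0 addr0 mul1r; lra.
rewrite /simple_integral fsbig_finite; last exact: fimfunP.
under eq_Rintegral do rewrite (fimfun_comp_sumE (fun=> phi)).
elim: (fset_set _ : seq _) => [|v l ih].
  rewrite big_nil phi0; under eq_Rintegral do rewrite big_nil.
  by rewrite Rintegral_cst// mul0r.
rewrite big_cons phiL ih; under [RHS]eq_Rintegral do rewrite big_cons.
have mi w : measurable_fun setT (\1_(s @^-1` [set w]) : T -> R).
  exact: measurable_indic.
have ile1 w x : `|\1_(s @^-1` [set w]) x| <= 1 :> R.
  by rewrite indicE ger0_norm//; case: (_ \in _).
have ii w : P.-integrable setT (EFin \o (\1_(s @^-1` [set w]) : T -> R)).
  exact: (integrable_bounded _ (mi w) (ile1 w)).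
rewrite RintegralD//; last 2 first.
- apply: (@integrable_bounded _ _ _ _ _ `|phi v|); first exact: measurable_funM.
  by move=> x; rewrite normrM ler_piMr.
- apply: (@integrable_bounded _ _ _ _ _ (\sum_(w <- l) `|phi w|)).
    by apply: measurable_sum => w; exact: measurable_funM.
  move=> x; rewrite (le_trans (ler_norm_sum _ _ _))//; apply: ler_sum => w _.
  by rewrite normrM ler_piMr.
congr (_ + _); rewrite RintegralZl// mulrC; congr (_ * _).
by rewrite /Rintegral integral_indic// setIT.
Qed.

End simple_functions.

(** * Inner product geometry of the reproducing kernel Hilbert space *)

Section rkhs_geometry.
Context {R : realType} {T : Type} {k : T -> T -> R} (H : rkhs k).
Local Notation dot := (@rkhs_dot R T k H).
Local Notation F := (@rkhs_section R T k H).
Implicit Types f g h : H.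

Lemma rkhs_dotBl f g h : dot (f - g) h = dot f h - dot g h.
Proof. by rewrite addrC -scaleN1r rkhs_dot_linear; ring. Qed.

Lemma rkhs_dotZl c f h : dot (c *: f) h = c * dot f h.
Proof.
have := rkhs_dot_linear c f 0 h; have := rkhs_dotBl h h h.
by rewrite subrr => ->; rewrite addr0 subrr addr0.
Qed.

Lemma rkhs_normB_sqr f g : `|f - g| ^+ 2 = `|f| ^+ 2 - 2 * dot f g + `|g| ^+ 2.
Proof.
rewrite -!rkhs_dot_norm rkhs_dotBl (rkhs_dotC f) (rkhs_dotC g (f - g)).
by rewrite !rkhs_dotBl (rkhs_dotC g f); ring.
Qed.

Lemma rkhs_cauchy_schwarz f g : `|dot f g| <= `|f| * `|g|.
Proof.
have [g0|g0] := eqVneq (`|g|) 0.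
  have -> : g = 0 by exact: normr0_eq0.
  have := rkhs_dotZl 0 0 f; rewrite scale0r mul0r rkhs_dotC => ->.
  by rewrite !normr0 mulr0.
have gg : 0 < `|g| ^+ 2 by rewrite exprn_gt0// lt_neqAle eq_sym g0/=.
rewrite -(@ler_pXn2r _ 2)// ?nnegrE ?mulr_ge0//.
rewrite -normrX ger0_norm ?sqr_ge0// exprMn.
(* Expand the squared distance from [f] to its orthogonal projection on the line of [g]. *)
have := sqr_ge0 (`|f - (dot f g / `|g| ^+ 2) *: g|).
rewrite rkhs_normB_sqr (rkhs_dotC f) rkhs_dotZl (rkhs_dotC g) normrZ exprMn.
rewrite -normrX (ger0_norm (sqr_ge0 _)).
rewrite (_ : _ + _ = `|f| ^+ 2 - dot f g ^+ 2 / `|g| ^+ 2); last by field.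
by rewrite subr_ge0 ler_pdivrMr.
Qed.

Lemma rkhs_dot_section x y : dot (F x) (F y) = k x y.
Proof. by rewrite -rkhs_reproducing rkhs_sectionE. Qed.

End rkhs_geometry.

(** * Bochner integrals of bounded maps into the Hilbert space *)

Section rkhs_bochner.
Context {d : measure_display} {T : measurableType d} {R : realType}.
Context {k : T -> T -> R} (H : rkhs k) (P : probability T R).
Local Notation dot := (@rkhs_dot R T k H).
Variables (F : T -> H) (M : R).
Hypothesis FM : forall x, `|F x| <= M.
Hypothesis mF : forall v, measurable_fun setT (fun x => `|F x - v|).

(** Polarization expresses the inner product through norms of differences, whose measurability is
    assumed. *)
Let mdot h : measurable_fun setT (fun x => dot (F x) h).
Proof.
rewrite (_ : (fun x => _) = fun x =>
  2^-1 * (`|F x - 0| ^+ 2 + `|h| ^+ 2 - `|F x - h| ^+ 2)).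
  apply: measurable_funM => //; apply: measurable_funB.
    by apply: measurable_funD => //; exact: measurable_funX.
  exact: measurable_funX.
by apply/funext => x; rewrite (rkhs_normB_sqr (F x) h) subr0; field.
Qed.

Section simple.
Variable s : {fimfun T >-> H}.
Hypothesis ms : forall v, measurable (s @^-1` [set v]).

Lemma integrable_dist_simple : P.-integrable setT (EFin \o (fun x => `|F x - s x|)).
Proof.
have [N sN] := fimfun_bounded s (fun v : H => `|v|).
apply: (@integrable_bounded _ _ _ _ _ (M + N)).
  exact: (measurable_fimfun_comp ms (psi := fun x v => `|F x - v|)).
move=> x; rewrite normr_id (le_trans (ler_normB _ _))// lerD//.
by have := sN x; rewrite normr_id.
Qed.

(** Cauchy-Schwarz under the integral sign. This weak estimate serves both to identify a Bochner
    integral and to show that one exists. *)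
Lemma dot_simple_integral_le h :
  `|dot (simple_integral P s) h - (\int[P]_x dot (F x) h)%R| <=
  `|h| * (\int[P]_x `|F x - s x|)%R.
Proof.
rewrite (@simple_integral_linear _ _ _ _ _ ms P (fun v => dot v h)); last first.
  by move=> c u v; exact: rkhs_dot_linear.
have [N sN] := fimfun_bounded s (fun v : H => dot v h).
have is_ : P.-integrable setT (EFin \o (fun x => dot (s x) h)).
  apply: integrable_bounded sN.
  exact: (measurable_fimfun_comp ms (psi := fun x v => dot v h)).
have iF : P.-integrable setT (EFin \o (fun x => dot (F x) h)).
  apply: (@integrable_bounded _ _ _ _ _ (M * `|h|)) => // x.
  by rewrite (le_trans (rkhs_cauchy_schwarz _ _))// ler_wpM2r.
rewrite -RintegralB// (le_trans (le_normr_Rintegral _ _))//.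
  by under [X in integrable _ _ X]eq_fun do rewrite /= EFinB; exact: integrableB.
rewrite -RintegralZl//; last exact: integrable_dist_simple.
apply: le_Rintegral => //.
- apply: integrable_norm.
  by under [X in integrable _ _ X]eq_fun do rewrite /= EFinB; exact: integrableB.
- under [X in integrable _ _ X]eq_fun do rewrite /= EFinM.
  by apply: integrableZl => //; exact: integrable_dist_simple.
- move=> x _; rewrite -rkhs_dotBl (le_trans (rkhs_cauchy_schwarz _ _))//.
  by rewrite mulrC distrC.
Qed.

End simple.

(** The inner products of [h] with the simple integrals tend to both sides, so a Bochner integral is
    also the weak integral. *)
Lemma dot_bochner_integral (m h : H) : is_bochner_integral P F m ->
  dot m h = (\int[P]_x dot (F x) h)%R.
Proof.
move=> [s [ms _ sF sm]].
have d0 : (\int[P]_x `|F x - s n x|)%R @[n --> \oo] --> (0 : R).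
  exact: (fine_cvg sF).
have c1 : dot (simple_integral P (s n)) h @[n --> \oo] --> (\int[P]_x dot (F x) h)%R.
  apply/cvgrPdist_le => e e0; near=> n.
  rewrite distrC (le_trans (dot_simple_integral_le (ms n) h))//.
  near: n.
  have : `|h| * (\int[P]_x `|F x - s n x|)%R @[n --> \oo] --> `|h| * (0 : R).
    by apply: cvgM => //; exact: cvg_cst.
  rewrite mulr0 => /cvgrPdist_le /(_ e e0); apply: filterS => n.
  by rewrite sub0r normrN; apply: le_trans; exact: ler_norm.
apply: (@cvg_unique R^o _ (dot (simple_integral P (s n)) h @[n --> \oo])) => //.
apply/cvgrPdist_le => e e0.
(* Adding 1 allows division when [h = 0]. *)
have h1 : 0 < `|h| + 1 by rewrite ltr_wpDl.
have : 0 < e / (`|h| + 1) by rewrite divr_gt0.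
move/cvgrPdist_le : sm => /[apply]; apply: filterS => n.
rewrite -rkhs_dotBl => mn; rewrite (le_trans (rkhs_cauchy_schwarz _ _))//.
rewrite ler_pdivlMr// in mn; apply: le_trans mn; rewrite ler_wpM2l// lerDl//.
Unshelve. all: by end_near.
Qed.

Lemma bochner_integral_exists (s : nat -> {fimfun T >-> H}) :
  (forall n v, measurable (s n @^-1` [set v])) -> (forall n x, `|s n x| <= M) ->
  (forall x, s n x @[n --> \oo] --> F x) ->
  exists m, is_bochner_integral P F m.
Proof.
move=> ms sM sF.
pose e n := (\int[P]_x `|F x - s n x|)%R.
have e0 : e n @[n --> \oo] --> (0 : R).
  have -> : 0 = (\int[P]_x (0 : R))%R by rewrite Rintegral_cst// mul0r.
  apply: (@cvg_Rintegral_bounded _ _ _ _ _ _ (M + M)).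
  - by move=> n; exact: (measurable_fimfun_comp (ms n) (psi := fun x v => `|F x - v|)).
  - by move=> n x; rewrite normr_id (le_trans (ler_normB _ _))// lerD.
  - move=> x; rewrite -(normr0 H) -(subrr (F x)); apply: cvg_norm.
    by apply: cvgB => //; exact: cvg_cst.
have dI n p : `|simple_integral P (s n) - simple_integral P (s p)| <= e n + e p.
  set h := _ - _.
  have [->|h0] := eqVneq (`|h|) 0.
    by rewrite addr_ge0// Rintegral_ge0.
  have {}h0 : 0 < `|h| by rewrite lt_neqAle eq_sym h0/=.
  (* Testing the difference [h] against itself turns the weak estimate into a norm estimate, so the
     simple integrals form a Cauchy sequence. *)
  rewrite -(ler_pM2l h0) -expr2 -rkhs_dot_norm {1}/h rkhs_dotBl mulrDr.
  have := dot_simple_integral_le (ms n) h; have := dot_simple_integral_le (ms p) h.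
  by rewrite !ler_norml -/(e n) -/(e p); lra.
have /cvg_ex[m sm] : cvg (simple_integral P (s n) @[n --> \oo]).
  apply/cauchy_cvgP/cauchy_exP => eps eps0.
  have : 0 < eps / 2 by rewrite divr_gt0.
  move/cvgrPdist_lt : e0 => /[apply] -[N _ Ne].
  exists (simple_integral P (s N)), N => // n /= Nn.
  rewrite -ball_normE/=; apply: le_lt_trans (dI _ _) _.
  have := Ne _ Nn; have := Ne _ (leqnn N); rewrite /= !sub0r !normrN.
  by move=> /ltr_normlW + /ltr_normlW; lra.
exists m, s; split => //.
- exact: aeW.
- rewrite (_ : (fun n => _) = EFin \o e); first by apply: cvg_EFin => //; exact: nearW.
  apply/funext => n; rewrite /e/= fineK//; apply: integrable_fin_num => //.
  exact: integrable_dist_simple.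
Qed.

End rkhs_bochner.

(** * Mean embeddings for exponential kernels with a dense sequence *)

Section exponential_kernel.
Context {d : measure_display} {T : measurableType d} {R : realType}.
Variables (k D : T -> T -> R) (c : R) (g : nat -> T).
Hypotheses (c0 : 0 < c) (kE : forall x y, k x y = expR (- (c * D x y))).
Hypotheses (D0 : forall x y, 0 <= D x y) (Dxx : forall x, D x x = 0).
Hypothesis mD : forall y, measurable_fun setT (D ^~ y).
Hypothesis gD : forall x (e : R), 0 < e -> exists i, D x (g i) < e.
Variable H : rkhs k.
Local Notation F := (@rkhs_section R T k H).

(** The section at the closest of the first [n + 1] points of the dense sequence: finitely many
    values, tending pointwise to the section at [x]. *)
Let near_section n x : H := F (g (nearest (fun i x => D x (g i)) n x)).

Let near_section_fin n : FiniteImage T H (near_section n).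
Proof.
split; apply: (sub_finite_set (B := (fun i => F (g i)) @` `I_n.+1)).
  move=> _ [x _ <-]; exists (nearest (fun i x => D x (g i)) n x) => //=.
  by rewrite ltnS nearest_le.
by apply: finite_image; exact: finite_II.
Qed.

Let s n : {fimfun T >-> H} := HB.pack (near_section n) (near_section_fin n).

Let ms n v : measurable (s n @^-1` [set v]).
Proof.
rewrite (_ : _ @^-1` _ = \bigcup_i
    ([set x | nearest (fun i x => D x (g i)) n x = i] `&` [set x | F (g i) = v])).
  apply: bigcupT_measurable => i; apply: measurableI.
    by apply: measurable_nearest => j; exact: mD.
  have [iv|iv] := pselect (F (g i) = v).
    by rewrite (_ : [set _ | _] = setT)//; apply/seteqP; split.
  by rewrite (_ : [set _ | _] = set0)//; apply/seteqP; split.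
apply/seteqP; split=> x /=; first by exists (nearest (fun i x => D x (g i)) n x).
by move=> [i _ [/= ni iv]]; rewrite /s/= /near_section ni.
Qed.

Let norm_section x : `|F x| = 1.
Proof.
apply/eqP; rewrite -(@eqrXn2 _ 2)// -rkhs_dot_norm rkhs_dot_section kE Dxx.
by rewrite mulr0 oppr0 expR0 expr1n.
Qed.

Let sF x : s n x @[n --> \oo] --> F x.
Proof.
apply/cvgrPdist_le => e e0.
(* For unit sections the squared distance is [2 - 2 expR (- c D)], which is at most [2 c D]; hence
   this threshold for [D]. *)
have d0 : 0 < e ^+ 2 / (2 * c) by rewrite divr_gt0 ?exprn_gt0 ?mulr_gt0.
have [i xi] := gD x d0; near=> n.
rewrite -(@ler_pXn2r _ 2)// ?nnegrE// ?(ltW e0)//.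
rewrite rkhs_normB_sqr !norm_section rkhs_dot_section kE expr1n.
set z := D x _; have zi : z <= D x (g i).
  by apply: (@nearest_min _ _ _ (fun i x => D x (g i))); near: n; exists i.
have := expR_ge1Dx (- (c * z)).
have : c * z <= e ^+ 2 / 2.
  rewrite (le_trans (ler_wpM2l (ltW c0) (le_trans zi (ltW xi))))//.
  by rewrite le_eqVlt; apply/orP; left; apply/eqP; field; rewrite gt_eqF.
lra.
Unshelve. all: by end_near.
Qed.

Let mF v : measurable_fun setT (fun x => `|F x - v|).
Proof.
apply: (@measurable_fun_cvg _ _ _ _ (fun n x => `|s n x - v|)).
  by move=> n; exact: (measurable_fimfun_comp (@ms n) (psi := fun _ w => `|w - v|)).
by move=> x _; apply: cvg_norm; apply: cvgB; [exact: sF|exact: cvg_cst].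
Qed.

Lemma mean_embedding_dot (P : probability T R) y :
  rkhs_dot (mean_embedding H P) (F y) = (\int[P]_x k x y)%R.
Proof.
have F1 x : `|F x| <= 1 by rewrite norm_section.
have [m Pm] := bochner_integral_exists P F1 mF ms
  (fun n x => F1 (g (nearest (fun i x => D x (g i)) n x))) sF.
(* Since a Bochner integral exists, the choice returns one and not the default 0. *)
have := xgetPex 0 (ex_intro _ m Pm).
rewrite -/(bochner_integral P F) => /(dot_bochner_integral F1 mF) ->.
by apply: eq_Rintegral => x _; rewrite rkhs_dot_section.
Qed.

Lemma mean_embedding_agree (P Q : probability T R) :
  mean_embedding H P = mean_embedding H Q -> forall y, agree P Q (k ^~ y).
Proof.
move=> PQ y; split.
- under eq_fun do rewrite kE -mulNr.
  by apply: measurableT_comp => //; exact: measurable_funM.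
- exists 1 => x; rewrite kE ger0_norm ?expR_ge0// expR_le1 oppr_le0.
  by rewrite mulr_ge0 ?(ltW c0).
- by rewrite -!mean_embedding_dot PQ.
Qed.

End exponential_kernel.
(** * Lebesgue measurable sets *)

Section lebesgue_measurable_sets.
Context {R : realType} {d : nat}.
Local Notation Rd := 'rV[R]_d.
Local Notation lambda := (@lebesgue_outer R d).

Lemma lebesgue_outer_bigcup_box (D : set nat) (b : nat -> Rd * Rd) :
  (lambda (\bigcup_(k in D) box (b k)) <= \esum_(k in D) (box_volume (b k))%:E)%E.
Proof. by apply: ereal_inf_lbound; exists (D, b). Qed.

Definition box_cut_le (i : 'I_d) (t : R) (ab : Rd * Rd) : Rd * Rd :=
  (ab.1, \row_j if j == i then Num.min (ab.2 ord0 j) t else ab.2 ord0 j).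

Definition box_cut_ge (i : 'I_d) (t : R) (ab : Rd * Rd) : Rd * Rd :=
  (\row_j (if j == i then Num.max (ab.1 ord0 j) t else ab.1 ord0 j), ab.2).

(** If the hyperplane misses the box, one of the two pieces has a reversed side and truncation gives
    it volume 0. *)
Lemma box_volume_cut i t ab :
  box_volume (box_cut_le i t ab) + box_volume (box_cut_ge i t ab) = box_volume ab.
Proof.
rewrite /box_volume (bigD1 i)//= [X in _ + X = _](bigD1 i)//= [RHS](bigD1 i)//=.
rewrite !mxE eqxx.
under [X in _ * X + _ = _]eq_bigr => j /negbTE ji do rewrite mxE ji.
under [X in _ + _ * X = _]eq_bigr => j /negbTE ji do rewrite mxE ji.
rewrite -mulrDl; congr (_ * _); rewrite /Num.max /Num.min.
by repeat case: ifPn; rewrite -?leNgt; lra.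
Qed.

(** Cutting every box of a cover along the hyperplane gives covers of the two parts with the same
    total volume, which is the Carathéodory inequality. Taking any set between the open and the
    closed half space covers both kinds. *)
Lemma half_space_measurable (i : 'I_d) (t : R) (A : set Rd) :
  (forall x : Rd, x ord0 i < t -> A x) -> (forall x, A x -> x ord0 i <= t) ->
  lebesgue_measurable A.
Proof.
move=> ltA Ale; apply: le_caratheodory_measurable => E.
apply: le_ereal_inf_tmp => _ [[D b] /= Eb <-].
under eq_esum do rewrite -(box_volume_cut i t) EFinD.
rewrite esumD; [|by move=> *; rewrite lee_fin box_volume_ge0..].
apply: leeD.
- apply: le_trans (lebesgue_outer_bigcup_box _ _).
  apply: le_outer_measure => x [/Eb[k Dk xk] /Ale xt]; exists k => // j /=.
  have /andP[h1 h2] := xk j; rewrite mxE; apply/andP; split; first exact: h1.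
  by case: eqP => [ji|_]; [rewrite le_min; apply/andP; split; [exact: h2|rewrite ji]|exact: h2].
- apply: le_trans (lebesgue_outer_bigcup_box _ _).
  apply: le_outer_measure => x [/Eb[k Dk xk] Ax]; exists k => // j /=.
  have xt : t <= x ord0 i by rewrite leNgt; apply/negP => /ltA.
  have /andP[h1 h2] := xk j; rewrite mxE; apply/andP; split; last exact: h2.
  by case: eqP => [ji|_]; [rewrite ge_max; apply/andP; split; [exact: h1|rewrite ji]|exact: h1].
Qed.

Lemma box_measurable ab : lebesgue_measurable (@box R d ab).
Proof.
rewrite (_ : box ab = \bigcap_(i in [set: 'I_d])
  ([set x : Rd | x ord0 i <= ab.2 ord0 i] `&` ~` [set x : Rd | x ord0 i < ab.1 ord0 i])).
  apply: (@fin_bigcap_measurable _ (caratheodory_type lambda)); first exact: finite_finset.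
  move=> i _; apply: (@measurableI _ (caratheodory_type lambda)).
    by apply: (@half_space_measurable i (ab.2 ord0 i)) => //= x /ltW.
  apply: (@measurableC _ (caratheodory_type lambda)).
  by apply: (@half_space_measurable i (ab.1 ord0 i)) => //= x /ltW.
apply/seteqP; split => x /= xab.
  by move=> i _; have /andP[h1 h2] := xab i; split => //=; apply/negP; rewrite -leNgt.
by move=> i; have [/= -> /negP] := xab i I; rewrite -leNgt => ->.
Qed.

Definition rat_box (q : 'rV[rat]_d * 'rV[rat]_d) : Rd * Rd :=
  (map_mx ratr q.1, map_mx ratr q.2).

(** An open set is the union of the countably many boxes with rational corners that it contains. *)
Lemma open_lebesgue_measurable (U : set Rd) : open U -> lebesgue_measurable U.
Proof.
move=> oU.
rewrite (_ : U = \bigcup_q (if `[< box (rat_box q) `<=` U >] then box (rat_box q) else set0)).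
  apply: (@countable_bigcupT_measurable _ (caratheodory_type lambda)) => // q.
  case: asboolP => _; first exact: box_measurable.
  exact: (@measurable0 _ (caratheodory_type lambda)).
apply/seteqP; split => x; last by move=> [q _]; case: asboolP => // qU /qU.
move=> Ux; have [e xeU] := nbhs_ex (open_nbhs_nbhs (conj oU Ux)).
have /choice[a ax] (i : 'I_d) : exists a : rat, x ord0 i - e%:num < ratr a < x ord0 i.
  have /rat_in_itvoo[a] : x ord0 i - e%:num < x ord0 i by rewrite ltrBlDr ltrDl.
  by rewrite in_itv/= => ax; exists a.
have /choice[b bx] (i : 'I_d) : exists b : rat, x ord0 i < ratr b < x ord0 i + e%:num.
  have /rat_in_itvoo[b] : x ord0 i < x ord0 i + e%:num by rewrite ltrDl.
  by rewrite in_itv/= => bx; exists b.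
exists (\row_i a i, \row_i b i) => //; case: asboolP => [_|].
  by move=> i; rewrite /= !mxE; have /andP[_ /ltW ->] := ax i; have /andP[/ltW -> _] := bx i.
case; move=> y yab; apply: xeU; split => // i j.
have := yab j; rewrite (ord1 i)/= !mxE => /andP[h1 h2].
rewrite -ball_normE/= distrC ltr_distl.
have /andP[h3 _] := ax j; have /andP[_ h4] := bx j.
by rewrite (lt_le_trans h3 h1) (le_lt_trans h2 h4).
Qed.

Lemma compact_lebesgue_measurable (X : set Rd) : compact X -> lebesgue_measurable X.
Proof.
move=> cX; rewrite -(setCK X); apply: (@measurableC _ (caratheodory_type lambda)).
apply: open_lebesgue_measurable; apply: closed_openC; apply: compact_closed => //.
Qed.

End lebesgue_measurable_sets.

(** * Approximation by finite unions of rational boxes *)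

Section rational_approximation.
Context {R : realType} {d : nat}.
Local Notation Rd := 'rV[R]_d.
Local Notation lambda := (@lebesgue_outer R d).
Local Notation rat_box := (@rat_box R d).

Lemma prod_shift_le (I : Type) (r : seq I) (m : I -> R) : (forall i, 0 <= m i) ->
  exists2 K, 0 <= K & forall t, 0 <= t <= 1 ->
    \prod_(i <- r) (m i + t) <= \prod_(i <- r) m i + t * K.
Proof.
move=> m0; elim: r => [|i r [K K0 ih]].
  by exists 0 => // t _; rewrite !big_nil mulr0 addr0.
have p0 : 0 <= \prod_(i <- r) m i by exact: prodr_ge0.
exists (m i * K + \prod_(i <- r) m i + K); first by rewrite !addr_ge0// mulr_ge0.
move=> t /[dup] t01 /andP[t0 t1]; rewrite !big_cons.
apply: (le_trans (ler_wpM2l (addr_ge0 (m0 i) t0) (ih t t01))).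
have : t * (t * K) <= t * K by rewrite ler_wpM2l// ler_piMl.
lra.
Qed.

Lemma rat_box_approx (ab : Rd * Rd) (e : R) : 0 < e ->
  exists q, box ab `<=` box (rat_box q) /\ box_volume (rat_box q) <= box_volume ab + e.
Proof.
move=> e0.
have [|K K0 volK] := prod_shift_le (index_enum 'I_d)
    (m := fun i => Num.max 0 (ab.2 ord0 i - ab.1 ord0 i)).
  by move=> i; rewrite le_max lexx.
(* Each end of a side moves by less than [t / 2], so a side grows by at most [t]. The choice ensures
   [t <= 1] and [t K <= e]. *)
pose t := Num.min 1 (e / (K + 1)).
have K1 : 0 < K + 1 by rewrite ltr_wpDl.
have t0 : 0 < t by rewrite lt_min ltr01 divr_gt0.
have /choice[a ax] (i : 'I_d) :
    exists a : rat, ab.1 ord0 i - t / 2 < ratr a < ab.1 ord0 i.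
  have : ab.1 ord0 i - t / 2 < ab.1 ord0 i by rewrite ltrBlDr ltrDl divr_gt0.
  by move=> /rat_in_itvoo[a]; rewrite in_itv/= => ax; exists a.
have /choice[b bx] (i : 'I_d) :
    exists b : rat, ab.2 ord0 i < ratr b < ab.2 ord0 i + t / 2.
  have : ab.2 ord0 i < ab.2 ord0 i + t / 2 by rewrite ltrDl divr_gt0.
  by move=> /rat_in_itvoo[b]; rewrite in_itv/= => bx; exists b.
exists (\row_i a i, \row_i b i); split.
  move=> x xab i; rewrite /= !mxE; have /andP[h1 h2] := xab i.
  have /andP[_ h3] := ax i; have /andP[h4 _] := bx i.
  by rewrite (ltW (lt_le_trans h3 h1)) (ltW (le_lt_trans h2 h4)).
have : 0 <= t <= 1 by rewrite (ltW t0) ge_min lexx.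
move=> /volK volt; have tK : t * K <= e.
  have : t <= e / (K + 1) by rewrite ge_min lexx orbT.
  rewrite ler_pdivlMr//; apply: le_trans; rewrite ler_wpM2l ?(ltW t0)// lerDl//.
apply: le_trans (le_trans volt _); last by rewrite lerD2l.
apply: ler_prod => i _; rewrite le_max lexx/= !mxE.
have /andP[h3 _] := ax i; have /andP[_ h4] := bx i.
rewrite ge_max addr_ge0 ?(ltW t0) ?le_max ?lexx//=.
have : ab.2 ord0 i - ab.1 ord0 i <= Num.max 0 (ab.2 ord0 i - ab.1 ord0 i).
  by rewrite le_max lexx orbT.
lra.
Qed.

Lemma rat_box_cover (A : set Rd) (e : R) : lambda A \is a fin_num -> 0 < e ->
  exists (D : set nat) (q : nat -> 'rV[rat]_d * 'rV[rat]_d),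
    A `<=` \bigcup_(k in D) box (rat_box (q k)) /\
    (\sum_(k <oo | k \in D) (box_volume (rat_box (q k)))%:E <= lambda A + e%:E)%E.
Proof.
move=> Afin e0; have e20 : 0 < e / 2 by rewrite divr_gt0.
have [_ [[D b] Ab <-]] := lb_ereal_inf_adherent e20 Afin.
rewrite -/(lambda A) /= => ble.
(* Half of [e] is spent on the near-optimal cover; the other half is shared geometrically among the
   enlargements. *)
have /choice[q bq] (k : nat) : exists q, box (b k) `<=` box (rat_box q) /\
    box_volume (rat_box q) <= box_volume (b k) + (e / 2) / (2 ^ k.+1)%:R.
  by apply: rat_box_approx; rewrite divr_gt0// ltr0n expn_gt0.
exists D, q; split.
  by move=> x /Ab[k Dk xk]; exists k => //; exact: (bq k).1.
apply: (@le_trans _ _ (\sum_(k <oo | k \in D)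
    ((box_volume (b k))%:E + ((e / 2) / (2 ^ k.+1)%:R)%:E))%E).
  by apply: lee_nneseries => k _; rewrite ?lee_fin ?box_volume_ge0//; exact: (bq k).2.
apply: le_trans (epsilon_trick _ _ (ltW e20)) _.
  by move=> k; rewrite lee_fin box_volume_ge0.
rewrite nneseries_esum; last by move=> k _; rewrite lee_fin box_volume_ge0.
rewrite set_mem_set [in leRHS](splitr e) EFinD addeA leeD2r//.
exact: ltW.
Qed.

Definition rat_boxes (L : seq ('rV[rat]_d * 'rV[rat]_d)) : set Rd :=
  [set x | exists2 q, q \in L & box (rat_box q) x].

Lemma rat_boxes_measurable L : lebesgue_measurable (rat_boxes L).
Proof.
rewrite (_ : rat_boxes L = \bigcup_(q in [set` L]) box (rat_box q)).
  apply: (@fin_bigcup_measurable _ (caratheodory_type lambda)).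
    exact: finite_seq.
  by move=> q _; exact: box_measurable.
by apply/seteqP; split => x [q Lq xq]; exists q.
Qed.

(** Keep the first [N] boxes of a near-optimal cover [U] of [A]. The error lies in [U] minus [A]
    together with the remaining boxes, whose total volume is the tail of a convergent series. *)
Lemma rat_boxes_approx (A : set Rd) (e : R) : lebesgue_measurable A ->
  lambda A \is a fin_num -> 0 < e ->
  exists L, (lambda (A `+` rat_boxes L) <= e%:E)%E.
Proof.
move=> mA Afin e0; have e20 : 0 < e / 2 by rewrite divr_gt0.
have [D [q [Aq qle]]] := rat_box_cover Afin e20.
set U := \bigcup_(k in D) _ in Aq.
have vol0 k : (0 <= (box_volume (rat_box (q k)))%:E)%E by rewrite lee_fin box_volume_ge0.
have UA : (lambda (U `\` A) <= (e / 2)%:E)%E.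
  have Ule : (lambda U <= lambda A + (e / 2)%:E)%E.
    apply: le_trans qle; rewrite nneseries_esum// set_mem_set.
    exact: lebesgue_outer_bigcup_box.
  (* Measurability of [A] splits the measure of [U], and the finite measure of [A] cancels. *)
  by move: Ule; rewrite (mA U) setIC (setIidl Aq) leeD2lE// -setDE.
have : (\sum_(N <= k <oo | k \in D) (box_volume (rat_box (q k)))%:E
          @[N --> \oo] --> 0)%E.
  apply: nneseries_tail_cvg => //; apply: (le_lt_trans qle).
  by rewrite lte_add_pinfty ?ltry// -ge0_fin_numE// outer_measure_ge0.
move=> /fine_cvg /cvgrPdist_le /(_ _ e20)[N _ /(_ N (leqnn N))].
rewrite /= sub0r normrN => tailN.
have tail_fin : (\sum_(N <= k <oo | k \in D) (box_volume (rat_box (q k)))%:E)%E \is a fin_num.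
  rewrite ge0_fin_numE; last exact: nneseries_ge0.
  apply: le_lt_trans (le_lt_trans qle _); last first.
    by rewrite lte_add_pinfty ?ltry// -ge0_fin_numE// outer_measure_ge0.
  rewrite eseries_cond; apply: subset_lee_nneseries => // k.
  by case/andP.
exists [seq q k | k <- iota 0 N & k \in D].
apply: (@le_trans _ _ (lambda (U `\` A `|`
    \bigcup_(k in [set k | (k \in D) && (N <= k)%N]) box (rat_box (q k))))).
  apply: le_outer_measure => x [[Ax nL]|[[p /mapP[k]]]].
    have [k Dk xk] := Aq _ Ax; right; exists k => //=; rewrite mem_set//=.
    rewrite leqNgt; apply/negP => kN; apply: nL; exists (q k) => //.
    by apply: map_f; rewrite mem_filter mem_iota mem_set.
  rewrite mem_filter => /andP[/set_mem Dk _] -> xk nA; left; split => //.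
  by exists k.
apply: (le_trans (outer_measureU2 _ _ _)).
rewrite [in leRHS](splitr e) EFinD leeD//.
apply: (le_trans (lebesgue_outer_bigcup_box _ _)).
rewrite -nneseries_esum// -eseries_cond -(fineK tail_fin) lee_fin.
exact: le_trans (ler_norm _) tailN.
Qed.

End rational_approximation.

(** * Absence of atoms in positive dimension *)

Section nonatomic.
Context {R : realType} {d : nat}.
Local Notation Rd := 'rV[R]_d.+1.
Local Notation lambda := (@lebesgue_outer R d.+1).

Lemma compact_coord_bounded (X : set Rd) : compact X ->
  exists2 M, 0 < M & forall x, X x -> forall i, `|x ord0 i| <= M.
Proof.
move=> /compact_bounded[M [_ XM]]; exists (`|M| + 1); first by rewrite ltr_wpDl.
move=> x Xx i; have : `|x| <= `|M| + 1.
  by apply: XM => //; rewrite ltr_pwDr// ler_norm.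
apply: le_trans; rewrite /Num.norm/= mx_normrE.
exact: (le_bigmax _ (fun ij : 'I_1 * 'I_d.+1 => `|x ij.1 ij.2|) (ord0, i)).
Qed.

(* Finitely many half spaces whose atoms in [X] are thin slabs. *)
Lemma small_atoms (X : set Rd) (e : R) : compact X -> 0 < e ->
  exists n (B : 'I_n -> set Rd), (forall j, lebesgue_measurable (B j)) /\
    forall C, C `<=` X -> (forall x y, C x -> C y -> forall j, B j x -> B j y) ->
      (lambda C <= e%:E)%E.
Proof.
move=> cX e0; have [M M0 XM] := compact_coord_bounded cX.
pose V := (2 * M) ^+ d; have V0 : 0 <= V by rewrite exprn_ge0// mulr_ge0// ltW.
(* A slab of thickness [2 h] and cross-section [V] then has volume at most [e]. *)
pose h := e / (2 * (V + 1)).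
have h0 : 0 < h by rewrite divr_gt0// mulr_gt0// ltr_wpDl.
(* The index [truncn z + 1] used below, with [z <= 2 M / h], has to be in range, hence [.+2]. *)
pose B (j : 'I_(Num.truncn (2 * M / h)).+2) : set Rd :=
  [set x | x ord0 ord0 < - M + j%:R * h].
exists (Num.truncn (2 * M / h)).+2, B; split.
  by move=> j; apply: (@half_space_measurable _ _ ord0 (- M + j%:R * h)) => //= x /ltW.
move=> C CX CB.
have Ch x y : C x -> C y -> y ord0 ord0 <= x ord0 ord0 + h.
  move=> Cx Cy; rewrite leNgt; apply/negP => xy.
  have := XM x (CX x Cx) ord0; rewrite ler_norml => /andP[x1 x2].
  (* The threshold of index [truncn z + 1] is above the first coordinate of [x] and, by the gap of
     more than [h], not above that of [y]: a half space separates them. *)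
  pose z := (x ord0 ord0 + M) / h.
  have z0 : 0 <= z by rewrite divr_ge0 ?(ltW h0)// -lerBlDr sub0r.
  have /andP[z1 z2] := truncn_itv z0.
  have jn : ((Num.truncn z).+1 < (Num.truncn (2 * M / h)).+2)%N.
    rewrite ltnS ltnS; apply: le_truncn; rewrite ler_wpM2r ?invr_ge0 ?(ltW h0)//.
    lra.
  have := CB x y Cx Cy (Ordinal jn); rewrite /B/=.
  rewrite ler_pdivlMr// in z1; rewrite ltr_pdivrMr// in z2.
  have : y ord0 ord0 >= - M + (Num.truncn z).+1%:R * h.
    by rewrite -natr1 mulrDl; lra.
  rewrite leNgt => /negP yz; apply: contra_not yz; apply; lra.
have [->|/set0P[x Cx]] := eqVneq C set0.
  by rewrite outer_measure0 lee_fin ltW.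
pose ab : Rd * Rd := (\row_i (if i == ord0 then x ord0 ord0 - h else - M),
                      \row_i (if i == ord0 then x ord0 ord0 + h else M)).
apply: (@le_trans _ _ (lambda (\bigcup_(k in [set 0%N]) box ab))).
  apply: le_outer_measure => y Cy; exists 0%N => // i; rewrite /= !mxE.
  case: eqP => [->|_]; first by rewrite (Ch x y)// andbT lerBlDr Ch.
  by rewrite -ler_norml XM//; exact: CX.
apply: (le_trans (lebesgue_outer_bigcup_box _ _)).
rewrite esum_set1 ?lee_fin ?box_volume_ge0// /box_volume big_ord_recl /= !mxE/=.
under eq_bigr do rewrite !mxE/= opprK -mulr2n -mulr_natl.
rewrite prodr_const card_ord.
rewrite !(max_idPr _); last 2 first.
- by rewrite mulr_ge0// ltW.
- lra.
rewrite -/V (_ : _ - _ = 2 * h); last lra.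
have : (2 * h) * (V + 1) = e by rewrite /h; field; rewrite gt_eqF// ltr_wpDl.
have : 0 <= h * 1 by rewrite mulr1 ltW.
lra.
Qed.

End nonatomic.
(** * Exponential estimates *)

Section exponential_estimates.
Context {R : realType}.
Implicit Types x y a b c K : R.

(** Everything follows from [1 + y <= expR y] at [y] and [- y]; the latter gives
    [expR y - 1 <= y * expR y]. *)
Lemma expR_sub1_le y : `|expR y - 1 - y| <= y ^+ 2 * expR `|y|.
Proof.
have h1 := expR_ge1Dx y; have h2 := expR_ge1Dx (- y).
have e0 : 0 < expR y by exact: expR_gt0.
have h3 : expR y - 1 <= y * expR y.
  have : (1 - y) * expR y <= expR (- y) * expR y by rewrite ler_wpM2r ?(ltW e0).
  by rewrite -expRD addNr expR0; lra.
rewrite ger0_norm; last lra.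
have [y0|y0] := leP 0 y.
  rewrite ger0_norm//; have := ler_wpM2l y0 h1; have := ler_wpM2l y0 h3; lra.
have h4 : 1 <= expR `|y| by rewrite -expR0 ler_expR.
have := ler_wpM2l (sqr_ge0 y) h4.
suff : expR y - 1 - y <= y ^+ 2 by lra.
have : 0 <= (- y) * (expR y - 1 - y) by rewrite mulr_ge0; lra.
lra.
Qed.

(* Only the exponents [- c x] and [c x] occur, yet this is [expR (b * x)] up to
   second order in [x]. *)
Definition exp_mix (c b x : R) : R :=
  (1 - b / c) / 2 * expR (- (c * x)) + (1 + b / c) / 2 * expR (c * x).

Lemma exp_mix_approx c K : 0 < c -> 0 <= K ->
  exists2 L, 0 <= L & forall b x, `|b| <= K -> 0 <= x <= 1 ->
    `|expR (b * x) - exp_mix c b x| <= L * x ^+ 2.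
Proof.
move=> c0 K0; pose L := K ^+ 2 * expR K + (1 + K / c) * (c ^+ 2 * expR c).
have Kc0 : 0 <= 1 + K / c by rewrite addr_ge0// divr_ge0// ltW.
exists L.
  apply: addr_ge0; first exact: mulr_ge0 (sqr_ge0 _) (expR_ge0 _).
  exact: mulr_ge0 Kc0 (mulr_ge0 (sqr_ge0 _) (expR_ge0 _)).
move=> b x bK /andP[x0 x1].
pose r y := expR y - 1 - y.
have Er y : expR y = 1 + y + r y by rewrite /r; lra.
have r_le y B : `|y| <= B * x -> 0 <= B -> `|r y| <= B ^+ 2 * expR B * x ^+ 2.
  move=> yB B0; rewrite (le_trans (expR_sub1_le y))//.
  rewrite [leRHS]mulrAC; apply: ler_pM; rewrite ?sqr_ge0 ?expR_ge0//.
    by rewrite -exprMn -real_normK ?num_real// lerXn2r// nnegrE mulr_ge0.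
  by rewrite ler_expR (le_trans yB)// ler_piMr.
have rb := r_le (b * x) K; have rc := r_le (c * x) c; have rNc := r_le (- (c * x)) c.
have c_ge0 := ltW c0.
rewrite normrM (ger0_norm x0) ler_wpM2r// in rb.
rewrite normrN normrM (ger0_norm x0) (ger0_norm c_ge0) lexx in rNc.
rewrite normrM (ger0_norm x0) (ger0_norm c_ge0) lexx in rc.
have {}rb := rb isT K0; have {}rc := rc isT c_ge0; have {}rNc := rNc isT c_ge0.
rewrite /exp_mix !Er.
set A := c ^+ 2 * expR c * x ^+ 2 in rc rNc.
(* The weights sum to 1 and produce slope [b], so constant and linear terms cancel and only the
   remainders [r] are left. *)
rewrite (_ : _ - _ = r (b * x) -
  ((1 - b / c) / 2 * r (- (c * x)) + (1 + b / c) / 2 * r (c * x))); last first.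
  by field; rewrite gt_eqF.
have bc : `|b / c| <= K / c by rewrite normrM normfV (gtr0_norm c0) ler_pM2r ?invr_gt0.
have A0 : 0 <= A by apply: le_trans rc.
have mix s t : `|s| <= K / c -> `|t| <= A -> `|(1 + s) / 2 * t| <= (1 + K / c) / 2 * A.
  move=> sK tA; rewrite normrM; apply: ler_pM => //; rewrite normrM (@ger0_norm _ 2^-1)//.
  by rewrite ler_wpM2r// (le_trans (ler_normD _ _))// normr1 lerD2l.
have h1 := mix (- (b / c)) (r (- (c * x))); have h2 := mix (b / c) (r (c * x)).
rewrite normrN in h1.
have {}h1 := h1 bc rNc; have {}h2 := h2 bc rc.
rewrite (le_trans (ler_normB _ _))// /L [leRHS]mulrDl lerD//.
rewrite (le_trans (ler_normD _ _))//.
rewrite (_ : _ * x ^+ 2 = (1 + K / c) / 2 * A + (1 + K / c) / 2 * A); last first.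
  by rewrite /A; field; rewrite gt_eqF.
exact: lerD.
Qed.

(** Replace the factors one at a time. An error [K x_i ^ 2] is at most [K e x_i], so the bound
    involves the sum of the [x_i] and not the number of factors. *)
Lemma prod_diff_le (I : Type) (r : seq I) (p q x : I -> R) (K L e : R) :
  0 <= K -> 0 <= L -> 0 <= e -> (forall i, 0 <= x i <= e) ->
  (forall i, `|p i| <= expR (L * x i)) -> (forall i, `|q i| <= expR (L * x i)) ->
  (forall i, `|p i - q i| <= K * x i ^+ 2) ->
  `|\prod_(i <- r) p i - \prod_(i <- r) q i| <=
    K * e * (\sum_(i <- r) x i) * expR (L * \sum_(i <- r) x i).
Proof.
move=> K0 L0 e0 xe pL qL pq; have x0 i : 0 <= x i by have /andP[] := xe i.
have pS s : `|\prod_(i <- s) p i| <= expR (L * \sum_(i <- s) x i).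
  rewrite normr_prod mulr_sumr expR_sum; apply: ler_prod => i _.
  by rewrite normr_ge0 pL.
elim: r => [|i r ih]; first by rewrite !big_nil subrr normr0 mulr0 mul0r.
rewrite !big_cons.
set Pp := \prod_(j <- r) p j in ih *; set Pq := \prod_(j <- r) q j in ih *.
set S := \sum_(j <- r) x j in ih *.
have S0 : 0 <= S by exact: sumr_ge0.
rewrite (_ : _ - _ = (p i - q i) * Pp + q i * (Pp - Pq)); last ring.
rewrite (le_trans (ler_normD _ _))// !normrM.
rewrite (_ : K * e * (x i + S) * _ = K * e * x i * expR (L * (x i + S))
   + expR (L * x i) * (K * e * S * expR (L * S))); last first.
  by rewrite [L * (x i + S)]mulrDr expRD; ring.
apply: lerD; last by apply: ler_pM.
apply: ler_pM => //.
  rewrite (le_trans (pq i))// -mulrA ler_wpM2l// expr2 ler_wpM2r//.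
  by have /andP[] := xe i.
rewrite (le_trans (pS r))// ler_expR ler_wpM2l// lerDr//.
Qed.

(** The constant [C] is chosen before the index set, so the error is [O(e)] uniformly over all
    partitions of mesh [e]. *)
Lemma exp_mix_prod_approx (c K S : R) : 0 < c -> 0 <= K ->
  exists2 C, 0 <= C & forall (I : Type) (r : seq I) (b x : I -> R) (e : R),
    0 <= e <= 1 -> (forall i, `|b i| <= K) -> (forall i, 0 <= x i <= e) ->
    \sum_(i <- r) x i <= S ->
    `|expR (\sum_(i <- r) b i * x i) - \prod_(i <- r) exp_mix c (b i) (x i)| <= C * e.
Proof.
move=> c0 K0; have [L L0 HL] := exp_mix_approx c0 K0.
exists (L * `|S| * expR ((K + L) * `|S|)); first by rewrite !mulr_ge0 ?expR_ge0.
move=> I r b x e /andP[e0 e1] bK xe xS; rewrite expR_sum.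
have KL0 : 0 <= K + L by rewrite addr_ge0.
have x01 i : 0 <= x i <= 1 by have /andP[-> /le_trans ->] := xe i.
have x0 i : 0 <= x i by have /andP[] := xe i.
have bx i : `|b i * x i| <= K * x i by rewrite normrM (ger0_norm (x0 i)) ler_wpM2r.
apply: le_trans (@prod_diff_le _ r _ _ x L (K + L) e _ _ _ _ _ _ _) _ => //.
- move=> i; rewrite ger0_norm ?expR_ge0// ler_expR.
  rewrite mulrDl (le_trans (ler_norm _))// (le_trans (bx i))// lerDl mulr_ge0//.
- move=> i; have qp := HL _ _ (bK i) (x01 i).
  (* With [x = x i], the mixture is at most [expR (K x) + L x ^ 2] in absolute value, hence at most
     [expR (K x) (1 + L x)]. *)
  rewrite mulrDl expRD -[exp_mix _ _ _](subKr (expR (b i * x i))).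
  rewrite (le_trans (ler_normB _ _))// (ger0_norm (expR_ge0 _)).
  have h1 : expR (b i * x i) <= expR (K * x i).
    by rewrite ler_expR (le_trans (ler_norm _)).
  have h2 : 1 <= expR (K * x i) by rewrite -expR0 ler_expR mulr_ge0.
  have h3 := expR_ge1Dx (L * x i).
  have h4 : L * x i ^+ 2 <= L * x i.
    by rewrite ler_wpM2l// expr2 ler_piMr//; have /andP[_] := x01 i.
  have h5 : 0 <= L * x i by rewrite mulr_ge0.
  have := ler_wpM2l (expR_ge0 (K * x i)) h3.
  by have := ler_wpM2r h5 h2; lra.
- by move=> i; exact: HL.
- have S0 : 0 <= \sum_(i <- r) x i by exact: sumr_ge0.
  have SS : \sum_(i <- r) x i <= `|S| by rewrite (le_trans xS)// ler_norm.
  rewrite (_ : L * `|S| * _ * _ = (L * e * `|S|) * expR ((K + L) * `|S|)); last ring.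
  by apply: ler_pM; rewrite ?mulr_ge0 ?expR_ge0// ?ler_wpM2l ?mulr_ge0// ler_expR ler_wpM2l.
Qed.

End exponential_estimates.
(** * The metric space of Lebesgue measurable sets *)

Section Lstar_theory.
Context {R : realType} {d : nat} {X : set 'rV[R]_d} (cX : compact X).
Local Notation Rd := 'rV[R]_d.
Local Notation lambda := (@lebesgue_outer R d).
Local Notation M := (Lstar cX).
Implicit Types x y : M.

Definition Lstar_set x : set Rd := val (repr x : Lset X).

Definition fine_lambda (A : set Rd) : R := fine (lambda A).

Lemma Lstar_set_measurable x : lebesgue_measurable (Lstar_set x).
Proof. by have [] := set_mem (valP (repr x : Lset X)). Qed.

Lemma Lstar_set_sub x : Lstar_set x `<=` X.
Proof. by have [] := set_mem (valP (repr x : Lset X)). Qed.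

Lemma lambda_fin A : A `<=` X -> lambda A \is a fin_num.
Proof.
move=> AX; rewrite ge0_fin_numE ?outer_measure_ge0//.
by apply: le_lt_trans (lebesgue_outer_compact cX); exact: le_outer_measure.
Qed.

Lemma fine_lambda_ge0 A : 0 <= fine_lambda A.
Proof. by rewrite fine_ge0// outer_measure_ge0. Qed.

Lemma le_fine_lambda A B : B `<=` X -> A `<=` B -> fine_lambda A <= fine_lambda B.
Proof.
move=> BX AB; rewrite fine_le ?lambda_fin//; first exact: subset_trans BX.
exact: le_outer_measure.
Qed.

Lemma Lstar_distE x y : Lstar_dist x y = fine_lambda (Lstar_set x `+` Lstar_set y).
Proof. by []. Qed.

Lemma Lstar_dist_ge0 x y : 0 <= Lstar_dist x y.
Proof. exact: fine_lambda_ge0. Qed.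

(** Distances to the class of [A] can be computed with [A] itself in place of the chosen
    representative. *)
Lemma exists_Lstar (A : set Rd) : lebesgue_measurable A -> A `<=` X ->
  exists a : M, forall x, Lstar_dist x a = fine_lambda (Lstar_set x `+` A).
Proof.
move=> mA AX.
have pA : A \in [set A : set Rd | lebesgue_measurable A /\ A `<=` X] by exact/mem_set.
exists (\pi_M (exist _ A pA : Lset X))%qT => x.
by rewrite -{1}(reprK x) Lstar_dist_pi.
Qed.

Lemma fine_lambdaDI (A B : set Rd) : lebesgue_measurable B -> A `<=` X ->
  fine_lambda A = fine_lambda (A `&` B) + fine_lambda (A `\` B).
Proof.
move=> mB AX; rewrite /fine_lambda (mB A) -setDE fineD// lambda_fin//.
  by move=> z [/AX].
by move=> z [/AX].
Qed.

Lemma fine_lambda_cells (I : finType) (C : I -> set Rd) (A : set Rd) :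
  lebesgue_measurable A -> (forall i, lebesgue_measurable (C i)) ->
  trivIset setT C -> A `<=` X -> A `<=` \bigcup_i C i ->
  fine_lambda A = \sum_i fine_lambda (A `&` C i).
Proof.
move=> mA mC tC AX AC; rewrite /fine_lambda sum_fine; last first.
  by move=> i _; apply: lambda_fin => z [/AX].
congr fine; rewrite [in LHS](_ : A = \bigcup_(i in [set` index_enum I]) (A `&` C i)).
  rewrite fsbig_seq ?index_enum_uniq//.
  pose mu : {outer_measure set Rd -> \bar R} := lambda.
  apply: (@measure_fin_bigcup _ R (caratheodory_type mu) mu) => //.
  - by apply: sub_trivIset (@subsetT _ _) _; exact: trivIset_setIl.
  - by move=> i _; apply: (@measurableI _ (caratheodory_type lambda)); [exact: mA|exact: mC].
apply/seteqP; split => [z Az|z [i _ []]//].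
by have [i _ Ci] := AC _ Az; exists i => //=; rewrite mem_index_enum.
Qed.

End Lstar_theory.

(** * Cells cut out by finitely many sets *)

Section cells.
Context {R : realType} {d : nat} {X : set 'rV[R]_d} (cX : compact X).
Local Notation Rd := 'rV[R]_d.
Local Notation lambda := (@lebesgue_outer R d).
Context {K : finType} (B : K -> set Rd).
Hypothesis mB : forall j, lebesgue_measurable (B j).
Local Notation pattern_type := {ffun K -> bool}.

(** The fibres of this map in [X] are the atoms of the algebra generated by the [B j]; some may be
    empty. *)
Definition pattern (z : Rd) : pattern_type := [ffun j => `[< B j z >]].

Definition cells (J : pred pattern_type) : set Rd := [set z | X z /\ J (pattern z)].

Definition cell (b : pattern_type) : set Rd := [set z | X z /\ pattern z = b].

Lemma cell_sub b : cell b `<=` X. Proof. by move=> z []. Qed.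

Lemma cell_measurable b : lebesgue_measurable (cell b).
Proof.
rewrite (_ : cell b = X `&` \bigcap_(j in [set: K]) (if b j then B j else ~` B j)).
  apply: (@measurableI _ (caratheodory_type lambda)).
    exact: compact_lebesgue_measurable.
  apply: (@fin_bigcap_measurable _ (caratheodory_type lambda)); first exact: finite_finset.
  move=> j _; case: (b j); first exact: mB.
  apply: (@measurableC _ (caratheodory_type lambda)); exact: mB.
apply/seteqP; split=> z [Xz zb]; split=> //.
  by move=> j _; rewrite -zb ffunE; case: asboolP.
apply/ffunP => j; rewrite ffunE; have := zb j I.
by case: (b j) => /= h; [exact/asboolP|exact/asboolPn].
Qed.

Lemma cells_measurable J : lebesgue_measurable (cells J).
Proof.
rewrite (_ : cells J = \bigcup_(b in [set b | J b]) cell b).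
  apply: (@fin_bigcup_measurable _ (caratheodory_type lambda)) => [|b _].
    exact: finite_finset.
  exact: cell_measurable.
apply/seteqP; split=> z; first by move=> [Xz Jz]; exists (pattern z).
by move=> [b /= Jb [Xz zb]]; split => //; rewrite zb.
Qed.

Lemma trivIset_cell : trivIset setT cell.
Proof. by move=> b b' _ _ [z [[_ <-] [_ <-]]]. Qed.

(** Inside a cell of the union the symmetric difference is the cell minus [x], and inside any other
    cell it is the part of [x] there. *)
Lemma fine_lambda_setY_cells (x : Lstar cX) J :
  fine_lambda (Lstar_set x `+` cells J) = \sum_b
    (if J b then fine_lambda (cell b) - fine_lambda (Lstar_set x `&` cell b)
     else fine_lambda (Lstar_set x `&` cell b)).
Proof.
have mx := Lstar_set_measurable x; have xX := @Lstar_set_sub _ _ _ _ x.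
rewrite (@fine_lambda_cells _ _ _ cX _ cell).
- apply: eq_bigr => b _; case: ifPn => Jb.
    rewrite (fine_lambdaDI cX mx (@cell_sub b)) (setIC (cell b)) [RHS]addrC addKr; congr fine_lambda.
    apply/seteqP; split => z.
      by move=> [[[xz nJ]|[Jz nx]] [Xz zb]] //; exfalso; apply: nJ; split => //; rewrite zb.
    move=> [[Xz zb] nx]; split; last by [].
    by right; split; [split => //; rewrite zb|].
  congr fine_lambda; apply/seteqP; split => z.
    by move=> [[[xz nJ]|[[_ Jz] nx]] [Xz zb]] //; exfalso; move: Jb; rewrite -zb Jz.
  by move=> [xz [Xz zb]]; split => //; left; split => // -[_]; rewrite zb; exact/negP.
- apply: (@measurableU _ (caratheodory_type lambda)).
    apply: (@measurableD _ (caratheodory_type lambda)); [exact: mx|exact: cells_measurable].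
  apply: (@measurableD _ (caratheodory_type lambda)); [exact: cells_measurable|exact: mx].
- exact: cell_measurable.
- exact: trivIset_cell.
- by move=> z [[/xX]|[[]]].
- move=> z [[/xX Xz _]|[[Xz _] _]]; by exists (pattern z).
Qed.

Lemma sum_fine_lambda_cell (A : set Rd) : lebesgue_measurable A -> A `<=` X ->
  \sum_b fine_lambda (A `&` cell b) = fine_lambda A.
Proof.
move=> mA AX; rewrite [RHS](@fine_lambda_cells _ _ _ cX _ cell) => //.
- exact: cell_measurable.
- exact: trivIset_cell.
- by move=> z /AX Xz; exists (pattern z).
Qed.

Variables (P Q : probability (LstarB cX) R) (c : R).
Hypothesis agree_kernel : forall a : Lstar cX,
  agree P Q (fun x : LstarB cX => expR (- (c * Lstar_dist (x : Lstar cX) a))).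

Lemma agree_prod_exp_mix (b : pattern_type -> R) :
  agree P Q (fun x : LstarB cX =>
    \prod_p exp_mix c (b p) (fine_lambda (Lstar_set (x : Lstar cX) `&` cell p))).
Proof.
under eq_fun do rewrite /exp_mix bigA_distr.
apply: agree_sum => J _.
have [a aE] := exists_Lstar cX (cells_measurable (fun p => p \notin J))
  (fun z (zJ : cells (fun p => p \notin J) z) => zJ.1).
(* [J] holds the cells that contribute [expR (- c x_p)]. The kernel at the union of the other cells
   has the right exponent up to a constant, which the second factor compensates. *)
rewrite (_ : (fun _ => _) = (fun x : LstarB cX =>
  ((\prod_p if p \in J then (1 - b p / c) / 2 else (1 + b p / c) / 2) *
   expR (c * \sum_(p | p \notin J) fine_lambda (cell p))) *
   expR (- (c * Lstar_dist (x : Lstar cX) a)))); last first.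
  apply/funext => x; rewrite aE fine_lambda_setY_cells -mulrA -expRD -mulrBr.
  rewrite [\sum_(p | _) _]big_mkcond -sumrB mulr_sumr expR_sum -big_split/=.
  apply: eq_bigr => p _; case: (p \in J) => /=; congr (_ * expR _); ring.
exact: agreeZ.
Qed.

End cells.

(** * Exponentials of sums of distances *)

Section exp_dist.
Context {R : realType} {d : nat} {X : set 'rV[R]_d} (cX : compact X).
Local Notation Rd := 'rV[R]_d.
Variables (P Q : probability (LstarB cX) R) (c : R).
Hypothesis c0 : 0 < c.
Hypothesis agree_kernel : forall a : Lstar cX,
  agree P Q (fun x : LstarB cX => expR (- (c * Lstar_dist (x : Lstar cX) a))).
Hypothesis fine_partition : forall e : R, 0 < e ->
  exists n (B : 'I_n -> set Rd), (forall j, lebesgue_measurable (B j)) /\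
    forall C, C `<=` X -> (forall x y, C x -> C y -> forall j, B j x -> B j y) ->
      (lebesgue_outer C <= e%:E)%E.

Lemma agree_exp_sum_dist (a : R) (s : seq (Lstar cX)) :
  agree P Q (fun x : LstarB cX =>
    expR (a * \sum_(g <- s) Lstar_dist (x : Lstar cX) g)).
Proof.
pose m := size s; pose K := `|a| * m%:R; have K0 : 0 <= K by rewrite mulr_ge0.
have [C C0 HC] := exp_mix_prod_approx (fine_lambda X) c0 K0.
apply: agree_approx => e e0.
pose N := expR (K * fine_lambda X) * C; have N0 : 0 <= N by rewrite mulr_ge0// expR_ge0.
(* The final error is [N h]. As [K] and [C] do not depend on the partition, its mesh can be fixed
   afterwards. *)
pose h := Num.min 1 (e / (N + 1)).
have N1 : 0 < N + 1 by rewrite ltr_wpDl.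
have h0 : 0 < h by rewrite lt_min ltr01 divr_gt0.
have h1 : h <= 1 by rewrite ge_min lexx.
have [n [B [mB Bh]]] := fine_partition h0.
pose g (k : 'I_m) := tnth (in_tuple s) k.
(* Refining by the sets [g k] themselves makes each of them a union of cells. *)
pose B' (j : 'I_n + 'I_m) : set Rd :=
  match j with inl i => B i | inr k => Lstar_set (g k) end.
have mB' j : lebesgue_measurable (B' j).
  by case: j => [i|k] /=; [exact: mB | exact: Lstar_set_measurable].
pose l p := fine_lambda (@cell _ _ X _ B' p).
pose xp p (x : Lstar cX) := fine_lambda (Lstar_set x `&` @cell _ _ X _ B' p).
have xp0 p x : 0 <= xp p x by exact: fine_lambda_ge0.
have l0 p : 0 <= l p by exact: fine_lambda_ge0.
have xpl p x : xp p x <= l p by apply: (le_fine_lambda cX) => //; exact: cell_sub.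
have lh p : l p <= h.
  rewrite -lee_fin /l/fine_lambda fineK ?(lambda_fin cX)//; last exact: cell_sub.
  apply: Bh; first exact: cell_sub.
  move=> y z [_ py] [_ pz] j Bjy.
  have /ffunP/(_ (inl j)) : pattern B' y = pattern B' z by rewrite py pz.
  by rewrite !ffunE /= (asboolT Bjy) => /esym/asboolP.
(* The distance to [g k] contributes [l p - xp p x] on a cell inside [g k] and [xp p x] elsewhere;
   [b] collects the slopes and [u] the constants. *)
pose b (p : {ffun 'I_n + 'I_m -> bool}) := a * \sum_(k < m) (if p (inr k) then -1 else 1).
pose u (p : {ffun 'I_n + 'I_m -> bool}) := a * \sum_(k < m) (if p (inr k) then l p else 0).
have bK p : `|b p| <= K.
  rewrite /b /K normrM ler_wpM2l// (le_trans (ler_norm_sum _ _ _))//.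
  rewrite -[m in m%:R]card_ord -sumr_const; apply: ler_sum => k _.
  by case: ifP => _; rewrite ?normrN normr1.
have uK p : u p <= K * l p.
  rewrite (le_trans (ler_norm _))// /u /K normrM -mulrA ler_wpM2l//.
  rewrite (le_trans (ler_norm_sum _ _ _))//.
  rewrite -[m in m%:R]card_ord -sumr_const mulr_suml; apply: ler_sum => k _.
  by rewrite mul1r; case: ifP => _; rewrite ?normr0// ger0_norm.
have distE (x : Lstar cX) : a * \sum_(y <- s) Lstar_dist x y =
    \sum_p u p + \sum_p b p * xp p x.
  rewrite (big_tnth _ _ s) -big_split/= (eq_bigr (fun k => \sum_(p : {ffun 'I_n + 'I_m -> bool})
     (if p (inr k) then l p - xp p x else xp p x))).
    rewrite exchange_big mulr_sumr; apply: eq_bigr => p _.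
    rewrite /u /b -mulrA -mulrDr; congr (_ * _).
    rewrite mulr_suml -big_split/=; apply: eq_bigr => k _.
    by case: ifP => _; ring.
  move=> k _; rewrite Lstar_distE -(fine_lambda_setY_cells mB' x
    (fun p : {ffun 'I_n + 'I_m -> bool} => p (inr k))).
  congr (fine_lambda (_ `+` _)); apply/seteqP; split => z.
    move=> gz; split; first exact: (Lstar_set_sub gz).
    by rewrite ffunE; exact/asboolP.
  by move=> [_]; rewrite ffunE => /asboolP.
exists (fun x : LstarB cX => expR (\sum_p u p) *
    \prod_p exp_mix c (b p) (xp p x)).
  by apply: agreeZ; exact: agree_prod_exp_mix.
move=> x; rewrite distE expRD -mulrBr normrM ger0_norm ?expR_ge0//.
have sl : \sum_p l p <= fine_lambda X.
  rewrite -(sum_fine_lambda_cell cX mB' (compact_lebesgue_measurable cX) (@subset_refl _ _)).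
  by apply: ler_sum => p _; apply: (le_fine_lambda cX) => [z []|z zp] //; split => //; exact: cell_sub zp.
have su : expR (\sum_p u p) <= expR (K * fine_lambda X).
  rewrite ler_expR (le_trans (ler_sum _ (fun p _ => uK p)))//.
  by rewrite -mulr_sumr ler_wpM2l.
apply: (@le_trans _ _ (expR (K * fine_lambda X) * (C * h))).
  apply: ler_pM; rewrite ?expR_ge0//.
  apply: HC => //; first by rewrite (ltW h0).
    by move=> p; rewrite xp0 (le_trans (xpl p x)).
  rewrite (le_trans _ sl)//; exact: ler_sum.
rewrite mulrA -/N (le_trans (_ : _ <= (N + 1) * h))//.
  by rewrite ler_wpM2r ?(ltW h0)// lerDl.
by rewrite -ler_pdivlMl// mulrC ge_min lexx orbT.
Qed.

End exp_dist.

(** * Separability and generation of the Borel sets *)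

Section Lstar_borel.
Context {R : realType} {d : nat} {X : set 'rV[R]_d} (cX : compact X).
Local Notation M := (Lstar cX).
Local Notation lambda := (@lebesgue_outer R d).

Lemma Lstar_separable : exists g : nat -> M,
  forall (x : M) (e : R), 0 < e -> exists i, Lstar_dist x (g i) < e.
Proof.
have mX := compact_lebesgue_measurable cX.
have /choice[G GE] (L : seq ('rV[rat]_d * 'rV[rat]_d)) : exists a : M,
    forall x, Lstar_dist x a = fine_lambda (Lstar_set x `+` (rat_boxes L `&` X)).
  apply: exists_Lstar; last by move=> z [].
  exact: (@measurableI _ (caratheodory_type lambda) _ _ (rat_boxes_measurable L) mX).
(* Traces on [X] of finite unions of rational boxes are dense; an index that codes no list yields
   the empty one. *)
exists (fun i => G (odflt [::] (choice.unpickle i))) => x e e0.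
have e20 : 0 < e / 2 by rewrite divr_gt0.
have xX := @Lstar_set_sub _ _ _ _ x.
have [L Le] := rat_boxes_approx (Lstar_set_measurable x) (lambda_fin cX xX) e20.
exists (choice.pickle L); rewrite choice.pickleK /= GE.
apply: (@le_lt_trans _ _ (e / 2)); last by rewrite ltr_pdivrMr// ltr_pMr// ltr1n.
rewrite -lee_fin fineK; last by apply: (lambda_fin cX) => z [[/xX]|[[]]].
apply: le_trans Le; apply: le_outer_measure => z [[xz nL]|[[Lz Xz] nx]].
  by left; split => // Lz; apply: nL; split => //; exact: xX.
by right.
Qed.

Lemma Lstar_ball_open (y : M) (r : R) : open [set x : M | Lstar_dist x y < r].
Proof.
rewrite openE => x /= xr; apply/nbhs_ballP.
exists (r - Lstar_dist x y); first by rewrite /= subr_gt0.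
move=> z; rewrite ballEmdist/= => xz.
have := Lstar_dist_triangle x z y; rewrite (Lstar_dist_sym z x).
by move: xz; rewrite /mdist/=; lra.
Qed.

Lemma Lstar_dist_measurable (y : M) :
  measurable_fun [set: LstarB cX] (fun x : LstarB cX => Lstar_dist (x : M) y).
Proof.
apply: (measurability _ (RGenInftyO.measurableE R)) => _ [_ [r ->] <-].
rewrite setTI; apply: sub_sigma_algebra.
rewrite (_ : _ @^-1` _ = [set x : M | Lstar_dist x y < r]); first exact: Lstar_ball_open.
by apply/seteqP; split => x; rewrite /= in_itv.
Qed.

(** By separability an open set is a countable union of balls centred in the dense sequence with
    radii [1 / (m + 1)]. *)
Lemma LstarB_measurable_ball_cap (A : set (LstarB cX)) : measurable A ->
  <<s range (ball_cap (fun (x : LstarB cX) (g : M) => Lstar_dist (x : M) g)) >> A.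
Proof.
have [g gd] := Lstar_separable.
pose G := range (ball_cap (fun (x : LstarB cX) (g : M) => Lstar_dist (x : M) g)).
apply: smallest_sub; first exact: smallest_sigma_algebra.
move=> U oU.
pose b (p : nat * nat) := [set x : M | Lstar_dist x (g p.1) < p.2.+1%:R^-1].
rewrite (_ : U = \bigcup_p (if `[< b p `<=` U >] then b p else set0)).
  apply: (@countable_bigcupT_measurable _ (g_sigma_algebraType G)) => // p.
  case: asboolP => _; last exact: (@measurable0 _ (g_sigma_algebraType G)).
  apply: sub_sigma_algebra; exists [:: (g p.1, p.2.+1%:R^-1)] => //.
  by apply/seteqP; split => x; rewrite /ball_cap/= andbT.
apply/seteqP; split => [x Ux|x [p _]]; last by case: asboolP => // pU /pU.
have [e /= e0 xeU] : nbhs_ball x U by apply/nbhs_ballP; exact: open_nbhs_nbhs.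
have [m me] : exists m, m.+1%:R^-1 < e / 2.
  have := near_infty_natSinv_lt (PosNum (divr_gt0 e0 (ltr0n R 2))).
  by move=> [m _ /(_ m (leqnn m))]; exists m.
have m0 : 0 < m.+1%:R^-1 :> R by rewrite invr_gt0.
have [i xi] := gd x _ m0.
exists (i, m) => //; case: asboolP => // -[] y; rewrite /b/= => yi.
apply: xeU; rewrite ballEmdist/=; have := Lstar_dist_triangle (g i) x y.
rewrite (Lstar_dist_sym (g i)) /mdist/=.
move/le_lt_trans; apply; rewrite (splitr e) ltrD//.
  exact: lt_trans xi me.
exact: lt_trans yi me.
Qed.

Lemma agree_two_points (P Q : probability (LstarB cX) R) (c : R) (p q : M) f :
  0 < c ->
  (forall a : M, agree P Q (fun x : LstarB cX => expR (- (c * Lstar_dist (x : M) a)))) ->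
  (forall x : M, x = p \/ x = q) -> agree P Q (f : LstarB cX -> R).
Proof.
move=> c0 agree_kernel pq.
have [e|npq] := eqVneq p q.
  rewrite (_ : f = fun x : LstarB cX => f p * expR (- (c * Lstar_dist (x : M) p))).
    exact: agreeZ.
  apply/funext => x; have -> : x = p by case: (pq x); rewrite -?e.
  by rewrite Lstar_distxx mulr0 oppr0 expR0 mulr1.
set t := expR (- (c * Lstar_dist p q)).
have pq0 : 0 < Lstar_dist p q.
  rewrite lt_neqAle Lstar_dist_ge0 andbT eq_sym.
  by apply: contra_neq npq; exact: Lstar_dist_positivity.
have t1 : t < 1 by rewrite expR_lt1 oppr_lt0 mulr_gt0.
have t0 : 0 < t by exact: expR_gt0.
have t2 : 1 - t ^+ 2 != 0 by rewrite gt_eqF// subr_gt0 exprn_ilt1// ltW.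
(* These coefficients solve the two-by-two system with diagonal 1 and off-diagonal [t], of
   determinant [1 - t ^ 2]. *)
rewrite (_ : f = fun x : LstarB cX =>
  (f p - t * f q) / (1 - t ^+ 2) * expR (- (c * Lstar_dist (x : M) p)) +
  (f q - t * f p) / (1 - t ^+ 2) * expR (- (c * Lstar_dist (x : M) q))).
  by apply: agreeD; exact: agreeZ.
apply/funext => x; case: (pq x) => ->.
  by rewrite Lstar_distxx mulr0 oppr0 expR0 -/t; field.
by rewrite Lstar_distxx (Lstar_dist_sym q) mulr0 oppr0 expR0 -/t; field.
Qed.

End Lstar_borel.

(** The ambient space is a single point, so a subset of [X] is empty or all of [X]. *)
Lemma Lstar_dim0 {R : realType} {X : set 'rV[R]_0} (cX : compact X) :
  exists p q : Lstar cX, forall x, x = p \/ x = q.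
Proof.
have [|p pE] := @exists_Lstar _ _ _ cX set0 _ (@sub0set _ _).
  exact: (@measurable0 _ (caratheodory_type (@lebesgue_outer R 0))).
have [q qE] := exists_Lstar cX (compact_lebesgue_measurable cX) (@subset_refl _ X).
have fine_lambda0 : fine_lambda (@set0 'rV[R]_0) = 0 by rewrite /fine_lambda outer_measure0.
exists p, q => x; have xX := @Lstar_set_sub _ _ _ _ x.
have [x0|/set0P[z xz]] := eqVneq (Lstar_set x) set0.
  by left; apply: Lstar_dist_positivity; rewrite pE x0 setYK.
right; apply: Lstar_dist_positivity; rewrite qE (_ : Lstar_set x = X) ?setYK//.
by apply/seteqP; split => // y _; rewrite (_ : y = z)// (thinmx0 y) (thinmx0 z).
Qed.

(** * Injectivity of the mean embedding *)

Lemma agree_exp_Lstar_dist {R : realType} {d : nat} {X : set 'rV[R]_d}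
  (cX : compact X) (P Q : probability (LstarB cX) R) (c : R) :
  0 < c ->
  (forall a : Lstar cX, agree P Q
    (fun x : LstarB cX => expR (- (c * Lstar_dist (x : Lstar cX) a)))) ->
  forall (a : R) (s : seq (Lstar cX)), agree P Q (fun x : LstarB cX =>
    expR (a * \sum_(g <- s) Lstar_dist (x : Lstar cX) g)).
Proof.
case: d X cX P Q => [|d] X cX P Q c0 agree_kernel a s.
  by have [p [q pq]] := Lstar_dim0 cX; apply: (agree_two_points _ c0 agree_kernel pq).
by apply: (agree_exp_sum_dist c0 agree_kernel) => e e0; exact: small_atoms.
Qed.

Theorem proposition3p3 (R : realType) (d : nat) (X : set 'rV[R]_d)
  (cX : compact X) (sigma : R) (sigma_gt0 : 0 < sigma) :
  characteristic (k_set cX sigma).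
Proof.
move=> H P Q PQ A mA.
have c0 : 0 < (2 * sigma ^+ 2)^-1 by rewrite invr_gt0 mulr_gt0// exprn_gt0.
have [g gd] := Lstar_separable cX.
pose D (x y : LstarB cX) : R := Lstar_dist (x : Lstar cX) y.
have kE x y : k_set cX sigma x y = expR (- ((2 * sigma ^+ 2)^-1 * D x y)).
  by rewrite /k_set /D mulNr mulrC.
have ak := mean_embedding_agree c0 kE (@Lstar_dist_ge0 _ _ _ cX)
  (@Lstar_distxx _ _ _ cX) (@Lstar_dist_measurable _ _ _ cX) gd PQ.
(* Finite intersections of balls generate the Borel sets, so only the exponentials of sums of
   distances remain to be treated. *)
apply: (probability_eq_g_sigma_ball_cap (D := D)); last exact: LstarB_measurable_ball_cap.
apply: (agree_exp_Lstar_dist c0) => y.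
by have := ak y; under eq_fun do rewrite kE.
Qed.
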